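(* Let $X$ and $Y$ be locally compact Polish spaces, let $\mu\in\mathcal{P}(X)$ and $\nu\in\mathcal{P}(Y)$ be Borel probability measures, and let $c:X\times Y\to\mathbb{R}\cup\{+\infty\}$ be Borel-measurable and (locally) integrable with respect to $\mu\otimes\nu$. If $\pi\in\Pi(\mu,\nu)$ is an optimal transport plan, i.e. a minimiser of $\mathcal{C}$ over $\Pi(\mu,\nu)$, with $\mathcal{C}(\pi)<\infty$, then $\pi$ is $c$-cyclically monotone.
   Context: $\Pi(\mu,\nu)$ is the set of transport plans, i.e. Borel probability measures on $X\times Y$ with first marginal $\mu$ and second marginal $\nu$. The transport cost is $\mathcal{C}(\pi):=\int_{X\times Y}c(x,y)\,\pi(dx,dy)$, and the optimal transport problem is $\min_{\pi\in\Pi(\mu,\nu)}\mathcal{C}(\pi)$. The word ''(locally)'' indicates that local integrability (integrability of $c$ over compact subsets of $X\times Y$ with respect to $\mu\otimes\nu$) is enough. A set $\Gamma\subset X\times Y$ is $c$-cyclically monotone if for every $n\in\mathbb{N}$ and all $(x_1,y_1),\dots,(x_n,y_n)\in\Gamma$ one has $\sum_{i=1}^n c(x_i,y_i)\le\sum_{i=1}^n c(x_i,y_{i+1})$, where $y_{n+1}:=y_1$. A plan $\pi\in\Pi(\mu,\nu)$ is $c$-cyclically monotone if there is a (measurable) $c$-cyclically monotone set $\Gamma\subset X\times Y$ with $\pi(\Gamma)=1$.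
   Formalization: The condition C(π) < ∞ is read as ''C(π) is finite'', so C(π) = −∞ is also excluded; the claim as worded fails for minimisers of cost −∞. *)

(* Defs.v *)
From HB Require Import structures.
From mathcomp Require Import all_boot all_order all_algebra.
From mathcomp Require Import all_classical all_reals all_analysis.
From mathcomp Require Import measurable_realfun.
Import Order.TTheory GRing.Theory Num.Theory.
Import numFieldNormedType.Exports.

Set Implicit Arguments.
Unset Strict Implicit.
Unset Printing Implicit Defensive.

Local Open Scope classical_set_scope.
Local Open Scope ring_scope.

Definition separable_space (T : topologicalType) : Prop :=
  exists2 D : set T, countable D & dense D.

Definition completely_metrizable (R : realType) (T : topologicalType) : Prop :=
  exists d : T -> T -> R,
    [/\ [/\ (forall x y, d x y = 0 <-> x = y),
            (forall x y, d x y = d y x) &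
            (forall x y z, d x z <= d x y + d y z)],
        (forall x (A : set T),
            nbhs x A <-> exists2 e : R, 0 < e & [set y | d x y < e] `<=` A) &
        (forall u : nat -> T,
            (forall e : R, 0 < e -> exists N : nat, forall m n : nat,
                (N <= m)%N -> (N <= n)%N -> d (u m) (u n) < e) ->
            exists l : T, u @ \oo --> l)].

Definition polish_space (R : realType) (T : topologicalType) : Prop :=
  separable_space T /\ completely_metrizable R T.

(* A pointed carrier loses no generality: a space that carries a probability
   measure is nonempty. *)
Notation borel T := (g_sigma_algebraType (@open T)).

Lemma polish_second_countable (R : realType) (T : topologicalType) :
  polish_space R T -> @second_countable T.
Proof.
move=> [[D cD dD] [d [[d0 dC dT] nbhsd _]]].
have dxx x : d x x = 0 by apply/d0.
pose B x (n : nat) := [set y | d x y < n.+1%:R^-1].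
have nbB x (e : R) : 0 < e -> nbhs x [set y | d x y < e].
  by move=> e0; apply/nbhsd; exists e.
have oB x n : open (B x n).
  rewrite openE => y /= xy; apply/nbhsd; exists (n.+1%:R^-1 - d x y).
    by rewrite subr_gt0.
  by move=> z /= yz; apply: (le_lt_trans (dT x y z)); rewrite -ltrBrDl.
exists [set B p.1 p.2 | p in D `*` [set: nat]].
  apply: sub_countable (card_image_le _ _) _.
  exact: countableX.
split; first by move=> _ [p _ <-]; exact: oB.
move=> x A /nbhsd[e e0 eA].
have [n ne] : exists n : nat, n.+1%:R^-1 < e / 2.
  have /ltr_add_invr[n nn] : 0 < e / 2 by rewrite divr_gt0.
  by exists n; rewrite add0r in nn.
have [a [/= xa Da]] : B x n `&` D !=set0.
  apply: dD => //; exists x; rewrite /B/= dxx invr_gt0 ltr0n//.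
exists (B a n).
  by split; [exists (a, n)|rewrite /B/= dC].
move=> y /= ay; apply: eA => /=; apply: (le_lt_trans (dT x a y)).
rewrite (splitr e); apply: ltrD; exact: lt_trans ne.
Qed.

Lemma measurable_prod_borel (R : realType) (X Y : ptopologicalType) :
  polish_space R X -> polish_space R Y ->
  @measurable _ (borel X * borel Y)%type = <<s (@open (X * Y)%type) >>.
Proof.
move=> /polish_second_countable[BX cBX [oBX bX]].
move=> /polish_second_countable[BY cBY [oBY bY]].
rewrite eqEsubset; split.
  apply: smallest_sub; first exact: smallest_sigma_algebra.
  rewrite subUset; split.
  - move=> _ [A mA <-]; rewrite setTI.
    move: A mA; apply: smallest_sub.
      split.
      + by rewrite /= preimage_set0; exact: sigma_algebra0.
      + by move=> A /= mA; rewrite setTD; exact: (@sigma_algebraC (X * Y)%type).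
      + move=> F /= mF; rewrite preimage_bigcup; exact: sigma_algebra_bigcup.
    move=> A oA /=; apply: sub_sigma_algebra.
    by apply: open_comp => // -[x y] _; exact: cvg_fst.
  - move=> _ [A mA <-]; rewrite setTI.
    move: A mA; apply: smallest_sub.
      split.
      + by rewrite /= preimage_set0; exact: sigma_algebra0.
      + by move=> A /= mA; rewrite setTD; exact: (@sigma_algebraC (X * Y)%type).
      + move=> F /= mF; rewrite preimage_bigcup; exact: sigma_algebra_bigcup.
    move=> A oA /=; apply: sub_sigma_algebra.
    by apply: open_comp => // -[x y] _; exact: cvg_snd.
apply: smallest_sub.
  split.
  - exact: measurable0.
  - by move=> A mA; rewrite setTD; exact: measurableC.
  - by move=> F mF; exact: bigcupT_measurable.
move=> U oU.
pose C := [set p | (BX `*` BY) p /\ p.1 `*` p.2 `<=` U].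
have UE : U = \bigcup_(p in C) (p.1 `*` p.2).
  rewrite eqEsubset; split => [[x y] Uxy|z [p [_ pU] /pU]//].
  have /= : nbhs (x, y) U by apply: open_nbhs_nbhs.
  move=> [[/= A B] [/= /bX[A' [BA' A'x] A'A] /bY[B' [BB' B'y] B'B]] ABU].
  exists (A', B') => //; split => // -[u v] [/= A'u B'v].
  by apply: ABU; split => /=; [exact: A'A|exact: B'B].
have /pfcard_geP[C0|/unsquash f] : countable C.
    apply: (sub_countable (B := BX `*` BY)); last exact: countableX.
    by apply: subset_card_le => p [].
  by rewrite UE C0 bigcup_set0; exact: measurable0.
have -> : U = \bigcup_(n in f @^-1` C) ((f n).1 `*` (f n).2).
  rewrite UE eqEsubset; split => [z [p Cp pz]|z [n Cn nz]]; last by exists (f n).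
  have [n _ fn] := 'surj_f Cp.
  by exists n; rewrite /= fn.
apply: bigcup_measurable => n [[/oBX ? /oBY ?] _].
apply: (@measurableX _ _ (borel X) (borel Y)); exact: sub_sigma_algebra.
Qed.

Section transport.
Local Open Scope ereal_scope.
Context (R : realType) (X Y : ptopologicalType).
(* For Polish X and Y the product sigma-algebra on [borel X * borel Y] is the
   Borel sigma-algebra of X * Y, see [measurable_prod_borel]. *)
Implicit Types (mu : probability (borel X) R) (nu : probability (borel Y) R).
Implicit Types (pi : probability (borel X * borel Y)%type R).
Implicit Types (c : X * Y -> \bar R).

Definition transport_plan mu nu pi : Prop :=
  (forall A : set (borel X), measurable A -> pushforward pi fst A = mu A) /\
  (forall B : set (borel Y), measurable B -> pushforward pi snd B = nu B).

Definition transport_cost c pi : \bar R := \int[pi]_z c z.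

(* The library integral returns -oo when the positive and the negative part
   both have infinite integral; such plans have no cost, and must not compete
   in the minimisation. *)
Definition has_transport_cost c pi : Prop :=
  \int[pi]_z (c^\+ z) < +oo \/ \int[pi]_z (c^\- z) < +oo.

Definition optimal_plan c mu nu pi : Prop :=
  [/\ transport_plan mu nu pi,
      has_transport_cost c pi &
      forall pi', transport_plan mu nu pi' -> has_transport_cost c pi' ->
        transport_cost c pi <= transport_cost c pi'].

(* [ordS] is the cyclic successor on 'I_n. *)
Definition c_cyclically_monotone c (Gamma : set (X * Y)) : Prop :=
  forall (n : nat) (z : 'I_n -> X * Y), (forall i, Gamma (z i)) ->
    \sum_(i < n) c (z i) <= \sum_(i < n) c ((z i).1, (z (ordS i)).2).

Definition c_cyclically_monotone_plan c pi : Prop :=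
  exists Gamma : set (borel X * borel Y),
    [/\ measurable Gamma, pi Gamma = 1 & c_cyclically_monotone c Gamma].

End transport.

(* Main.v *)
(* If the plan is not cyclically monotone, bad n-tuples of points (those whose
   cyclic swap lowers the cost by a definite amount, all costs involved being
   bounded) cannot be avoided by discarding a null set.  A capacitability
   argument in the style of Kellerer then yields a nonzero measure [lam] on
   n-tuples, carried by the bad ones, whose marginals sum to at most the plan;
   swapping the second coordinates along [lam] gives a cheaper plan.
   The transfer to the Cantor space (a Polish space is a Borel retract of it)
   serves twice: measurable sets of tuples become projections of closed sets, to
   which Choquet's argument applies, and an additive function on clopen sets,
   supplied by Hahn-Banach duality, is automatically a measure. *)

Require Import Defs.
From HB Require Import structures.
From mathcomp Require Import all_boot all_order all_algebra.
From mathcomp Require Import all_classical all_reals all_analysis.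
From mathcomp Require Import measurable_realfun.
From mathcomp Require Import ring lra.
Import Order.TTheory GRing.Theory Num.Theory.
Import numFieldNormedType.Exports.

Set Implicit Arguments.
Unset Strict Implicit.
Unset Printing Implicit Defensive.

Local Open Scope classical_set_scope.
Local Open Scope ring_scope.

(** * Hahn-Banach for additive functions *)

(** The cost is merely Borel, so the sets of bad tuples have no topological structure, whereas the
    duality argument handles only decreasing sequences of clopen sets. Passing from a Borel set to
    such a sequence needs a set function that is continuous from below. The natural candidate is
    linear: the infimum of the integrals of phi over the phi >= 0 whose values at the coordinates of
    each bad tuple sum to at least 1. Its continuity from below would call for a weak compactness
    argument; with phi^2 in place of phi the parallelogram law is enough. The change is harmless at
    both ends. For phi with values in [0, 1] one has phi^2 <= phi, so a positive quadratic value
    bounds the linear one from below, as duality requires. A zero quadratic value still yields a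
    null set that meets every bad tuple, by Chebyshev and Borel-Cantelli. *)

Section hahn_banach.
Context (R : realType) (V : zmodType).
Implicit Types p q : V -> R.

(** Only natural multiples exist in a [zmodType], so homogeneity is asked for these alone. For
    positive [n], subadditivity gives the reverse inequality; [n = 0] gives [0 <= p 0]. *)
Definition sublinear p :=
  (forall x y, p (x + y) <= p x + p y) /\
  (forall x n, p x *+ n <= p (x *+ n)).

Lemma sublinear0 p : sublinear p -> p 0 = 0.
Proof.
move=> [pD pM]; apply/eqP; rewrite eq_le; apply/andP; split.
  by have := pM 0 2%N; rewrite mul0rn; lra.
by have := pM 0 0%N; rewrite mulr0n.
Qed.

Lemma sublinear_geN p x : sublinear p -> - p (- x) <= p x.
Proof. by move=> sp; have := sp.1 x (- x); rewrite subrr (sublinear0 sp); lra. Qed.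

(** Supplies the bounds of chains for Zorn. Directedness makes the infimum subadditive:
    near-minimisers at [x] and at [y] are replaced by one member below both. *)
Lemma sublinear_bigcap p (A : set (V -> R)) (q0 : V -> R) : A q0 ->
  (forall q, A q -> sublinear q /\ forall x, q x <= p x) ->
  (forall q r, A q -> A r -> exists2 s, A s & forall x, s x <= q x /\ s x <= r x) ->
  let q x := inf [set r x | r in A] in
  sublinear q /\ forall r x, A r -> q x <= r x.
Proof.
move=> Aq0 Ap dirA q.
have lbA x : has_inf [set r x | r in A].
  split; first by exists (q0 x), q0.
  exists (- p (- x)) => _ [r Ar <-]; have [sr rp] := Ap _ Ar.
  by apply: (le_trans _ (sublinear_geN x sr)); rewrite lerN2.
have qle r x : A r -> q x <= r x by move=> Ar; apply: ge_inf; [case: (lbA x)|exists r].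
split=> //; split=> [x y|x n].
  have q1 e : 0 < e -> q (x + y) <= q x + q y + e.
    move=> e0; have e20 : 0 < e / 2 by rewrite divr_gt0.
    have [_ [r Ar <-] rx] := inf_adherent e20 (lbA x).
    have [_ [s As <-] sy] := inf_adherent e20 (lbA y).
    have [t At tle] := dirA _ _ Ar As.
    have /(_ x y) := (Ap _ At).1.1; have := qle _ (x + y) At.
    have := (tle x).1; have := (tle y).2; rewrite /q in rx sy *; lra.
  by apply/ler_addgt0Pr.
case: n => [|n].
  rewrite !mulr0n; apply: lb_le_inf; first by exists (q0 0), q0.
  by move=> _ [r Ar <-]; rewrite (sublinear0 (Ap _ Ar).1).
apply: lb_le_inf; first by exists (q0 (x *+ n.+1)), q0.
move=> _ [r Ar <-]; apply: (le_trans _ ((Ap _ Ar).1.2 x n.+1)).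
by rewrite lerMn2r qle ?orbT.
Qed.

(** The one-dimensional extension step of Hahn-Banach, without subspaces: [p] is lowered until it is
    odd along [x]. At a minimal sublinear functional nothing can be lowered, so such a functional is
    odd, hence additive. *)
Lemma sublinear_linearize p x : sublinear p ->
  let q y := inf [set p (y + x *+ n) - p x *+ n | n in [set: nat]] in
  [/\ sublinear q, forall y, q y <= p y & q (- x) <= - p x].
Proof.
move=> sp q; have [pD pM] := sp.
have lbq y : has_inf [set p (y + x *+ n) - p x *+ n | n in [set: nat]].
  split; first by exists (p (y + x *+ 0) - p x *+ 0), 0%N.
  exists (- p (- y)) => _ [n _ <-].
  have := pD (y + x *+ n) (- y); rewrite addrAC subrr add0r.
  by have := pM x n; lra.
have qle y n : q y <= p (y + x *+ n) - p x *+ n.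
  by apply: ge_inf; [case: (lbq y)|exists n].
split; last 2 first.
- by move=> y; apply: (le_trans (qle y 0%N)); rewrite !mulr0n subr0 addr0.
- by apply: (le_trans (qle _ 1%N)); rewrite !mulr1n addNr (sublinear0 sp) sub0r.
split=> [y z|y n].
  apply/ler_addgt0Pr => e e0; have e20 : 0 < e / 2 by rewrite divr_gt0.
  have [_ [n _ <-] ny] := inf_adherent e20 (lbq y).
  have [_ [m _ <-] mz] := inf_adherent e20 (lbq z).
  have := qle (y + z) (n + m)%N; rewrite !mulrnDr addrACA.
  have := pD (y + x *+ n) (z + x *+ m); rewrite /q in ny mz *; lra.
apply: lb_le_inf; first exact: (lbq _).1.
move=> _ [m _ <-]; case: n => [|n].
  by rewrite !mulr0n add0r subr_ge0 pM.
(* With [m * n] more copies of [x] the argument becomes [(y + x *+ m) *+ n.+1], to which [pM]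
   applies; these copies cost at most [p x *+ (m * n)]. *)
have -> : p (y *+ n.+1 + x *+ m) - p x *+ m =
          p (y *+ n.+1 + x *+ m) + p x *+ (m * n) - p x *+ (m * n.+1).
  by rewrite mulnS mulrnDr; lra.
have pxmn : p (x *+ (m * n)) <= p x *+ (m * n).
  elim: (m * n)%N => [|k IH]; first by rewrite !mulr0n (sublinear0 sp).
  by rewrite !mulrS; apply: le_trans (pD _ _) _; lra.
have := pD (y *+ n.+1 + x *+ m) (x *+ (m * n)).
rewrite -addrA -mulrnDr -mulnS mulrnA -mulrnDl => h.
have := pM (y + x *+ m) n.+1; have : q y *+ n.+1 <= (p (y + x *+ m) - p x *+ m) *+ n.+1.
  by rewrite lerMn2r qle orbT.
rewrite mulrnBl -[p x *+ m *+ _]mulrnA; lra.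
Qed.

Lemma hahn_banach_additive p x0 : sublinear p ->
  exists f : V -> R, [/\ forall x y, f (x + y) = f x + f y,
    forall x, f x <= p x & p x0 <= f x0].
Proof.
move=> sp; have [] := sublinear_linearize x0 sp.
(* Starting Zorn from [p1] instead of [p] secures the last clause: whatever lies below [p1] is at
   most [- p x0] at [- x0]. *)
set p1 := (fun y => inf _) => sp1 p1p p1x0.
pose T := {q : V -> R | sublinear q /\ forall x, q x <= p1 x}.
(* Reversed order: the maximal element that Zorn provides is a minimal functional. *)
pose leT (s t : T) := `[< forall x, sval t x <= sval s x >].
have t0 : T by exists p1.
have [//| | | |f fmin] := @Zorn T leT.
- by move=> t; apply/asboolP.
- move=> s t u /asboolP st /asboolP tu; apply/asboolP => x.
  exact: le_trans (tu x) (st x).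
- move=> [s s'] [t t'] /asboolP/= st /asboolP/= ts; apply: eq_exist => /=.
  by apply/funext => x; apply/eqP; rewrite eq_le st ts.
- move=> A totA; have [[a Aa]|] := pselect (A !=set0); last first.
    by move=> A0; exists t0 => s As; case: A0; exists s.
  pose B := [set sval s | s in A].
  have [| | |sB Bq] := @sublinear_bigcap p1 B (sval a).
  + by exists a.
  + by move=> _ [s As <-]; exact: (svalP s).
  + move=> _ _ [s As <-] [t At <-].
    have [/asboolP st|/asboolP st] := totA s t As At.
    * by exists (sval t) => [|x]; [by exists t|split; [|exact: lexx]].
    * by exists (sval s) => [|x]; [by exists s|split; [exact: lexx|]].
  unshelve eexists (exist _ (fun x => inf [set r x | r in B]) _) => /=.
    split=> // x; apply: le_trans (Bq _ x (ex_intro2 _ _ a Aa erefl)) _.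
    exact: (svalP a).2.
  by move=> s As; apply/asboolP => x /=; apply: Bq; exists s.
have [sf fp1] := svalP f.
have fN x : sval f (- x) <= - sval f x.
  have [sq qf qx] := sublinear_linearize x sf.
  set q := (fun y => inf _) in sq qf qx.
  have qT : sublinear q /\ forall x, q x <= p1 x.
    by split=> // y; apply: le_trans (qf y) (fp1 y).
  have /(congr1 sval)/= qE : exist _ q qT = f by apply: fmin; apply/asboolP.
  by move: qx; rewrite -[inf _]/(q (- x)) qE.
exists (sval f); split.
- move=> x y; apply/eqP; rewrite eq_le sf.1 /=.
  have := sf.1 (x + y) (- y); rewrite addrK; have := fN y; lra.
- by move=> x; apply: le_trans (fp1 x) (p1p x).
- have := sublinear_geN x0 sf; have := fp1 (- x0); lra.
Qed.

End hahn_banach.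

(** * Pushforwards and mixtures of measures *)

Section measure_constructions.
Local Open Scope ereal_scope.
Context (R : realType).

Lemma pushforward_measure d d' (T : measurableType d) (T' : measurableType d')
    (m : {measure set T -> \bar R}) (f : T -> T') : measurable_fun setT f ->
  exists m' : {measure set T' -> \bar R}, (forall A, m' A = m (f @^-1` A)) /\
    forall g, measurable_fun setT g -> (forall x, 0 <= g x) ->
      \int[m']_x g x = \int[m]_x g (f x).
Proof.
move=> mf; pose pm : {measure set T' -> \bar R} := pushforward m f.
exists (pm mf); split=> // g mg g0.
by rewrite ge0_integral_pushforward// preimage_setT.
Qed.

Lemma sum_measure d (T : measurableType d) n
    (m : 'I_n -> {measure set T -> \bar R}) :
  exists m' : {measure set T -> \bar R}, (forall A, m' A = \sum_(i < n) m i A) /\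
    forall g, measurable_fun setT g -> (forall x, 0 <= g x) ->
      \int[m']_x g x = \sum_(i < n) \int[m i]_x g x.
Proof.
elim: n m => [|n IH] m.
  exists mzero; split=> [A|g mg g0]; first by rewrite big_ord0.
  by rewrite big_ord0 integral_measure_zero.
have [m1 [m1E im1]] := IH (fun i => m (widen_ord (leqnSn n) i)).
exists (measure_add m1 (m ord_max)); split=> [A|g mg g0].
  by rewrite [LHS]measure_addE m1E big_ord_recr.
by rewrite ge0_integral_measure_add// im1// big_ord_recr.
Qed.

(** Serves twice: with the coordinates of the tuples it recovers the plan, with the swapped
    coordinates it is the competitor. *)
Lemma mixture_measure d d' (Om : measurableType d) (T : measurableType d') n
    (sig lam : {measure set Om -> \bar R}) (g : Om -> T) (z : 'I_n -> Om -> T) :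
  measurable_fun setT g -> (forall i, measurable_fun setT (z i)) ->
  exists m : {measure set T -> \bar R},
    (forall B, m B = sig (g @^-1` B) + \sum_(i < n) lam (z i @^-1` B)) /\
    forall f, measurable_fun setT f -> (forall x, 0 <= f x) ->
      \int[m]_x f x =
      \int[sig]_w f (g w) + \sum_(i < n) \int[lam]_w f (z i w).
Proof.
move=> mg mz; have [s [sE isE]] := pushforward_measure sig mg.
have /choice[l lP] i := pushforward_measure lam (mz i).
have [L [LE iL]] := sum_measure l.
exists (measure_add s L); split=> [B|f mf f0].
  rewrite [LHS]measure_addE sE LE; congr (_ + _).
  by apply: eq_bigr => i _; rewrite (lP i).1.
rewrite ge0_integral_measure_add// isE// iL//; congr (_ + _).
by apply: eq_bigr => i _; rewrite (lP i).2.
Qed.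

Lemma probability_of_measure d (T : measurableType d)
    (m : {measure set T -> \bar R}) : m setT = 1 ->
  exists P : probability T R, forall A, P A = m A.
Proof.
move=> m1; exists (mnormalize m (dirac point)) => A.
by rewrite [LHS]/= /mnormalize m1 onee_eq0/= invr1 mule1.
Qed.

End measure_constructions.

(** * The Cantor space *)

Definition determined N (A : set (nat -> bool)) :=
  forall w w', (forall i, (i < N)%N -> w i = w' i) -> A w -> A w'.

(** By compactness these are exactly the clopen subsets of the Cantor space; in this form topology
    reduces to finite prefixes. *)
Definition clopens : set (set (nat -> bool)) :=
  [set A | exists N, determined N A].

Notation bitstream := (g_sigma_algebraType clopens).

(* Most recent bit first. *)
Fixpoint prefix N (w : nat -> bool) : seq bool :=
  if N is N'.+1 then w N' :: prefix N' w else [::].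

Definition cylinder (s : seq bool) : set (nat -> bool) :=
  [set w | prefix (size s) w = s].

Lemma eq_prefix N w w' :
  prefix N w = prefix N w' <-> forall i, (i < N)%N -> w i = w' i.
Proof.
elim: N => [|N [IH1 IH2]] //=; split=> [[wN /IH1 IH] i|ww'].
  by rewrite ltnS leq_eqVlt => /predU1P[->//|/IH].
by rewrite ww'// IH2// => i iN; rewrite ww'// ltnW.
Qed.

Lemma cylinder_nil : cylinder [::] = setT.
Proof. by apply/seteqP; split. Qed.

Lemma cylinder_cons b s w :
  cylinder (b :: s) w <-> cylinder s w /\ w (size s) = b.
Proof. by split=> [[wb ws]|[ws wb]] //; rewrite /cylinder/= ws wb. Qed.

Lemma cylinder_split s : cylinder s =
  cylinder (false :: s) `|` cylinder (true :: s).
Proof.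
apply/seteqP; split=> w /=.
  by move=> sw; have [ws|/negbTE ws] := boolP (w (size s));
    [right|left]; exact/cylinder_cons.
by move=> [|] /cylinder_cons[].
Qed.

Lemma cylinder_split_disjoint s :
  cylinder (false :: s) `&` cylinder (true :: s) = set0.
Proof.
by apply/seteqP; split=> // w [] /cylinder_cons[_ w0] /cylinder_cons[_]; rewrite w0.
Qed.

Lemma clopensT : clopens setT. Proof. by exists 0%N. Qed.

Lemma clopens0 : clopens set0. Proof. by exists 0%N. Qed.

Lemma clopensC A : clopens A -> clopens (~` A).
Proof.
move=> [N dA]; exists N => w w' ww' Aw Aw'; apply: Aw.
by apply: dA Aw' => i iN; rewrite ww'.
Qed.

Lemma clopensI A B : clopens A -> clopens B -> clopens (A `&` B).
Proof.
move=> [M dA] [N dB]; exists (maxn M N) => w w' ww' [Aw Bw]; split.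
  by apply: dA Aw => i iM; rewrite ww'// leq_max iM.
by apply: dB Bw => i iN; rewrite ww'// leq_max iN orbT.
Qed.

Lemma clopensU A B : clopens A -> clopens B -> clopens (A `|` B).
Proof.
move=> cA cB; rewrite -[A `|` B]setCK setCU.
exact/clopensC/clopensI/clopensC/cB/clopensC.
Qed.

Lemma clopens_cylinder s : clopens (cylinder s).
Proof. by exists (size s) => w w' /eq_prefix; rewrite /cylinder/= => ->. Qed.

Lemma clopens_measurable : clopens `<=` @measurable _ bitstream.
Proof. exact: sub_sigma_algebra. Qed.

(** Cylinders are split bit by bit down to a level that determines the set; there each cylinder is
    either contained in the set or disjoint from it. *)
Lemma clopens_ind (Q : set (nat -> bool) -> Prop) :
  Q set0 -> (forall s, Q (cylinder s)) ->
  (forall A B, clopens A -> clopens B -> A `&` B = set0 -> Q A -> Q B ->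
     Q (A `|` B)) ->
  forall A, clopens A -> Q A.
Proof.
move=> Q0 Qc QU A [N dA].
suff H k s : (size s + k = N)%N -> Q (A `&` cylinder s).
  by rewrite -[A]setIT -cylinder_nil; exact: (H N).
elim: k s => [|k IH] s.
  rewrite addn0 => sN; have [[w [Aw sw]]|nA] := pselect (A `&` cylinder s !=set0).
    suff -> : A `&` cylinder s = cylinder s by [].
    apply/seteqP; split=> [w' []//|w' sw']; split=> //.
    by apply: dA Aw; apply/eq_prefix; rewrite -sN sw'.
  suff -> : A `&` cylinder s = set0 by [].
  by apply/seteqP; split=> // w Asw; apply: nA; exists w.
move=> skN; rewrite cylinder_split setIUr; apply: QU.
- apply: clopensI (clopens_cylinder _); by exists N.
- apply: clopensI (clopens_cylinder _); by exists N.
- by rewrite setIACA cylinder_split_disjoint setI0.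
- by apply: IH; rewrite /= addSnnS.
- by apply: IH; rewrite /= addSnnS.
Qed.

Lemma measurable_fun_bitstream d (T : measurableType d) (f : T -> bitstream) :
  (forall k, measurable [set t | f t k]) -> measurable_fun setT f.
Proof.
move=> mf; apply: (@measurability _ _ T bitstream setT f clopens) => // _ [A cA <-].
rewrite setTI; elim/clopens_ind : A / cA.
- by rewrite preimage_set0.
- elim=> [|b s IH]; first by rewrite cylinder_nil preimage_setT.
  have -> : f @^-1` cylinder (b :: s) =
      f @^-1` cylinder s `&` (if b then [set t | f t (size s)]
                              else ~` [set t | f t (size s)]).
    apply/seteqP; split=> t /=; rewrite cylinder_cons => -[? fb]; split=> //.
      by case: b fb => /= ->.
    by case: b fb => //= /negP/negbTE.
  by apply: measurableI => //; case: b => //; exact: measurableC.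
- by move=> A B _ _ _ mA mB; rewrite preimage_setU; exact: measurableU.
Qed.

Lemma measurable_bit k : measurable [set w : bitstream | w k].
Proof. by apply: clopens_measurable; exists k.+1 => w w' /(_ k) /= ->. Qed.

Lemma bitstream_measure_unique (R : realType)
    (m1 m2 : {measure set bitstream -> \bar R}) :
  (m1 setT < +oo)%E -> (forall A, clopens A -> m1 A = m2 A) ->
  forall A, measurable A -> m1 A = m2 A.
Proof.
move=> m1oo m12 A mA; apply: (@measure_unique _ R bitstream clopens (fun=> setT)) => //.
- exact: clopensI.
- by move=> _; exact: clopensT.
- by apply: bigcup_const; exists 0%N.
Qed.

Section clopen_content.
Context (R : realType) (a : set (nat -> bool) -> R).
Hypothesis a_ge0 : forall A, clopens A -> 0 <= a A.
Hypothesis aU : forall A B, clopens A -> clopens B -> A `&` B = set0 ->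
  a (A `|` B) = a A + a B.

Let a_split s : a (cylinder s) =
  a (cylinder (false :: s)) + a (cylinder (true :: s)).
Proof.
rewrite {1}cylinder_split aU//; first exact: clopens_cylinder.
- exact: clopens_cylinder.
- exact: cylinder_split_disjoint.
Qed.

(* The intervals [left_end s, left_end s + a (cylinder s)[ for [s] of a given
   length partition [0, a setT[. *)
Fixpoint left_end (s : seq bool) : R :=
  if s is b :: s' then
    left_end s' + (if b then a (cylinder (false :: s')) else 0)
  else 0.

(** For [u] in [[0, a setT[], this is the word of length [N] whose interval contains [u]. *)
Fixpoint address_prefix (N : nat) (u : R) : seq bool :=
  if N is N'.+1 then
    (left_end (true :: address_prefix N' u) <= u) :: address_prefix N' u
  else [::].

Definition address (u : R) : bitstream := fun k => head false (address_prefix k.+1 u).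

Let prefix_address N u : prefix N (address u) = address_prefix N u.
Proof. by elim: N => //= N ->. Qed.

Let size_address N u : size (address_prefix N u) = N.
Proof. by elim: N => //= N ->. Qed.

Let address_cylinder s u : 0 <= u < a setT ->
  cylinder s (address u) <-> left_end s <= u < left_end s + a (cylinder s).
Proof.
move=> u0.
have -> : cylinder s (address u) = (address_prefix (size s) u = s).
  by rewrite /cylinder/= prefix_address.
elim: s => [|b s IH].
  by rewrite /= cylinder_nil add0r; split.
have := a_split s; have := a_ge0 (clopens_cylinder (false :: s)).
have := a_ge0 (clopens_cylinder (true :: s)).
rewrite [address_prefix _ _]/= => a1 a0 as01; split.
  move=> [+ us]; rewrite us /= => bE; have /andP[su us'] := IH.1 us.
  case: b bE => [bE|/negbT]; rewrite -?ltNge; lra.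
move=> H; have us : address_prefix (size s) u = s.
  by apply: IH.2; case: b H => /= /andP[]; lra.
by rewrite us; congr cons; case: b H => /= H; [lra|apply: negbTE; rewrite -ltNge; lra].
Qed.

Let left_end_bounds s : 0 <= left_end s <= a setT - a (cylinder s).
Proof.
elim: s => [|b s /andP[s0 sT]]; first by rewrite cylinder_nil subrr lexx.
have := a_split s; have := a_ge0 (clopens_cylinder (false :: s)).
have := a_ge0 (clopens_cylinder (true :: s)).
by case: b => /=; lra.
Qed.

Let measurable_address : measurable_fun setT address.
Proof.
have mp s : measurable [set u | address_prefix (size s) u = s].
  elim: s => [|b s IH]; first by rewrite (_ : [set _ | _] = setT)//; apply/seteqP; split.
  have -> : [set u | address_prefix (size (b :: s)) u = b :: s] =
      [set u | address_prefix (size s) u = s] `&`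
      [set u | (left_end (true :: s) <= u) = b].
    apply/seteqP; split=> u /=; first by move=> [+ us]; rewrite us.
    by move=> [-> <-].
  apply: measurableI => //; case: b.
    rewrite (_ : [set _ | _] = [set` `[left_end (true :: s), +oo[])//.
    by apply/seteqP; split=> u /=; rewrite in_itv/= andbT.
  rewrite (_ : [set _ | _] = [set` `]-oo, left_end (true :: s)[])//.
  by apply/seteqP; split=> u /=; rewrite in_itv/= ltNge; [move=> ->|move/negbTE].
apply: measurable_fun_bitstream => k.
have -> : [set u | address u k] = \bigcup_s (
    if size s == k then [set u | address_prefix (size (true :: s)) u = true :: s]
    else set0).
  apply/seteqP; split=> u /=.
    move=> uk; exists (address_prefix k u) => //=; rewrite size_address eqxx/=.
    by move: uk; rewrite /address/= => ->.
  by move=> [s _]; case: eqP => // <-; rewrite /address /= => -[-> _].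
apply: countable_bigcupT_measurable => [|s]; first exact: countableP.
by case: ifP.
Qed.

(** Countable additivity is inherited from Lebesgue measure: its image under [address], restricted
    to [[0, a setT[], gives each cylinder the length of its interval, and additivity extends the
    agreement to clopen sets. *)
Lemma clopen_content_measure : exists m : {measure set bitstream -> \bar R},
  forall A, clopens A -> m A = (a A)%:E.
Proof.
pose I := [set` `[0, a setT[]; have mI : measurable I by exact: measurable_itv.
have [m mE] : exists m : {measure set bitstream -> \bar R},
    forall A, m A = lebesgue_measure (address @^-1` A `&` I).
  have [m [mE _]] := pushforward_measure (mrestr (@lebesgue_measure R) mI) measurable_address.
  by exists m => A; rewrite mE.
exists m => A; elim/clopens_ind => {A}.
- have := aU clopens0 clopens0 (setI0 _); rewrite setU0 => a0.
  by rewrite measure0; congr EFin; lra.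
- move=> s; rewrite mE.
  have a0 := a_ge0 (clopens_cylinder s).
  have -> : address @^-1` cylinder s `&` I =
      [set` `[left_end s, left_end s + a (cylinder s)[].
    have /andP[s0 sT] := left_end_bounds s.
    apply/seteqP; split=> u /=; rewrite !in_itv/=.
      by move=> [/[swap] u0 /(address_cylinder s u0)].
    move=> us; have u0 : 0 <= u < a setT by case/andP: us; lra.
    by split=> //; apply/(address_cylinder s u0).
  rewrite lebesgue_measure_itv/= lte_fin ltrDl.
  case: ltP => a0'; first by rewrite -EFinB addrAC subrr add0r.
  by congr EFin; apply/eqP; rewrite eq_le a0 a0'.
- move=> A B cA cB AB0 mA mB; have mUE := measureU m (clopens_measurable cA) (clopens_measurable cB) AB0.
  by rewrite mUE; move: mA mB => /= -> ->; rewrite aU.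
Qed.

End clopen_content.

(** * Analytic sets and capacitability *)

Lemma seq_dependent_choice (T : Type) (Q : seq T -> Prop) : inhabited T ->
  Q [::] -> (forall s, Q s -> exists x, Q (rcons s x)) ->
  exists f : nat -> T, forall k, Q (mkseq f k).
Proof.
move=> [x0] Q0 QS.
have /choice[g gQ] : forall s, exists x, Q s -> Q (rcons s x).
  move=> s; have [/QS[x Qx]|nQ] := pselect (Q s); first by exists x.
  by exists x0.
pose S k := iter k (fun s => rcons s (g s)) [::].
have SE k : S k = mkseq (fun i => g (S i)) k.
  by elim: k => // k IH; rewrite /S iterS -/(S k) mkseqS -IH.
exists (fun i => g (S i)) => k; rewrite -SE.
by elim: k => // k IH; rewrite /S iterS; exact: gQ.
Qed.

(** Koenig's lemma. A word is good if sequences [y k] with arbitrarily large [k] extend it; since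
    the next entry is bounded, finitely many letters compete and one of them keeps the word good. *)
Lemma konig_bounded (y : nat -> nat -> nat) (m : nat -> nat) :
  (forall k i, (i < k)%N -> (y k i <= m i)%N) ->
  exists z : nat -> nat, forall M, exists2 k, (M <= k)%N &
    forall i, (i < M)%N -> y k i = z i.
Proof.
move=> ym.
pose good s := forall M, exists2 k, (M <= k)%N &
  forall i, (i < size s)%N -> y k i = nth 0 s i.
have [||z zg] := @seq_dependent_choice _ good (inhabits 0); last first.
- exists z => M; have [k Mk kz] := zg M M; exists k => // i iM.
  by rewrite kz ?size_mkseq// nth_mkseq.
- move=> s gs; apply: contrapT => /forallNP ngs.
  have /choice[N Ns] : forall v, exists N, forall k, (N <= k)%N ->
      ~ (forall i, (i < size (rcons s v))%N -> y k i = nth 0 (rcons s v) i).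
    move=> v; have /existsNP[N /forall2NP HN] := ngs v; exists N => k Nk.
    by case: (HN k).
  (* The first term makes the bound [m] valid for entry [size s] of [y k]; the second exceeds the
     failure thresholds of all letters allowed there. *)
  pose M := maxn (size s).+1 (\max_(v < (m (size s)).+1) N v).
  have [k Mk ks] := gs M.
  have ym_s : (y k (size s) < (m (size s)).+1)%N.
    by rewrite ltnS ym//; apply: leq_trans Mk; rewrite leq_max leqnn.
  apply: (Ns (y k (size s)) k).
    apply: leq_trans Mk; rewrite leq_max; apply/orP; right.
    exact: (leq_bigmax (Ordinal ym_s)).
  move=> i; rewrite size_rcons ltnS leq_eqVlt nth_rcons => /predU1P[->|ils].
    by rewrite ltnn eqxx.
  by rewrite ils ks.
- by move=> M; exists M.
Qed.

(* Analytic sets, as projections of closed subsets of the product of the Cantor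
   space and the Baire space. *)
Definition closed_relation (F : (nat -> bool) -> (nat -> nat) -> Prop) :=
  forall w y, (forall M, exists w' y', F w' y' /\
    forall i, (i < M)%N -> w' i = w i /\ y' i = y i) -> F w y.

Definition analytic (E : set (nat -> bool)) :=
  exists2 F, closed_relation F & E = [set w | exists y, F w y].

Lemma analytic_clopen A : clopens A -> analytic A.
Proof.
move=> [N dA]; exists (fun w _ => A w).
  move=> w y /(_ N)[w' [y' [Aw' ww']]]; apply: dA Aw' => i /ww'[] //.
by apply/seteqP; split=> w /=; [exists (fun=> 0%N)|move=> []].
Qed.

(** The first entry of the witness names the member of the union, and the rest is a witness for that
    member. *)
Lemma analytic_bigcup (E : nat -> set (nat -> bool)) :
  (forall k, analytic (E k)) -> analytic (\bigcup_k E k).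
Proof.
move=> /(_ _)/cid2-/all_sig2[F cF EF].
exists (fun w y => F (y 0%N) w (fun i => y i.+1)).
  move=> w y wy; apply: cF => M; have [w' [y' [Fw' ww']]] := wy M.+1.
  exists w', (fun i => y' i.+1); rewrite -(ww' 0%N _).2//; split=> // i iM.
  by split; [apply: (ww' i _).1; rewrite ltnW|apply: (ww' i.+1 _).2].
apply/seteqP; split=> w /=.
  move=> [k _]; rewrite EF => -[y Fy].
  by exists (fun i => if i is i'.+1 then y i' else k).
by move=> [y Fy]; exists (y 0%N) => //; rewrite EF; eexists; exact: Fy.
Qed.

Lemma analytic_bigcap (E : nat -> set (nat -> bool)) :
  (forall k, analytic (E k)) -> analytic (\bigcap_k E k).
Proof.
move=> /(_ _)/cid2-/all_sig2[F cF EF].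
exists (fun w y => forall k, F k w (fun j => y (pickle (k, j)))).
  move=> w y wy k; apply: cF => M.
  (* One witness interleaves those for all [k], so agreement must reach the codes of all [(k, j)]
     with [j < M]. *)
  have [w' [y' [Fw' ww']]] := wy (maxn M (\max_(j < M) (pickle (k, val j)).+1)).
  exists w', (fun j => y' (pickle (k, j))); split=> // i iM; split.
    by apply: (ww' i _).1; rewrite leq_max iM.
  apply: (ww' _ _).2; rewrite leq_max; apply/orP; right.
  exact: (@leq_bigmax _ (fun j : 'I_M => (pickle (k, val j)).+1) (Ordinal iM)).
apply/seteqP; split=> w /=.
  move=> Ew; have /choice[y Fy] : forall k, exists y, F k w y.
    by move=> k; have := Ew k I; rewrite EF.
  exists (fun i => if unpickle i is Some (k, j) then y k j else 0%N) => k.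
  by under eq_fun do rewrite pickleK.
by move=> [y Fy] k _; rewrite EF; eexists; exact: Fy.
Qed.

(** Analytic sets are not stable under complement, so the induction carries a set together with its
    complement. *)
Lemma measurable_analytic (E : set bitstream) : measurable E -> analytic E.
Proof.
move=> mE; suff [] : analytic E /\ analytic (~` E) by [].
move: E mE; apply: smallest_sub => [|A cA]; last first.
  by split; apply: analytic_clopen => //; exact: clopensC.
split.
- by rewrite setC0; split; apply: analytic_clopen; [exact: clopens0|exact: clopensT].
- by move=> A [aA aCA]; rewrite setTD setCK.
- move=> A aA; split; first by apply: analytic_bigcup => k; case: (aA k).
  by rewrite setC_bigcup; apply: analytic_bigcap => k; case: (aA k).
Qed.

Lemma choquet_capacitability (R : realType) (C : set (nat -> bool) -> R)
    (E : set bitstream) (delta : R) :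
  (forall A B, A `<=` B -> C A <= C B) ->
  (forall A : nat -> set (nat -> bool), (forall k, A k `<=` A k.+1) ->
    (forall k, C (A k) <= delta) -> C (\bigcup_k A k) <= delta) ->
  measurable E -> delta < C E ->
  exists K : nat -> set (nat -> bool), [/\ forall k, clopens (K k),
    forall k, K k.+1 `<=` K k, \bigcap_k K k `<=` E & forall k, delta < C (K k)].
Proof.
move=> Cmono Cup /measurable_analytic[F cF EF] dE.
(* Bounds on the entries of the witness are fixed one at a time. [B s] is the increasing union of
   its refinements, so by continuity from below some next bound keeps the capacity above [delta]. *)
pose B s := [set w | exists2 y, F w y & forall i, (i < size s)%N -> (y i <= nth 0 s i)%N].
have [||m Bm] := @seq_dependent_choice _ (fun s => delta < C (B s)) (inhabits 0%N).
- by apply: (lt_le_trans dE); apply: Cmono; rewrite EF => w [y Fy]; exists y.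
- move=> s; apply: contraPP => /forallNP nB; apply/negP; rewrite -leNgt.
  have -> : B s = \bigcup_m B (rcons s m).
    apply/seteqP; split=> w.
      move=> [y Fy ys]; exists (y (size s)) => //; exists y => // i.
      rewrite size_rcons ltnS leq_eqVlt nth_rcons => /predU1P[->|ils].
        by rewrite ltnn eqxx.
      by rewrite ils ys.
    move=> [m _ [y Fy ys]]; exists y => // i ils.
    by have := ys i; rewrite size_rcons nth_rcons ils ltnS ltnW// => /(_ isT).
  apply: Cup => m; last by rewrite leNgt; apply/negP; exact: nB.
  move=> w [y Fy ys]; exists y => // i; rewrite size_rcons => ils.
  have := ys i; rewrite size_rcons ils !nth_rcons => /(_ isT).
  by case: ltnP => // _; case: eqP => // _ /leq_trans; apply.
(* Only the first [k] bits of [w] are constrained, which makes [K k] clopen. A point of all [K k]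
   has witnesses bounded by [m]; [konig_bounded] extracts a limit, and closedness of [F] puts the
   point in [E]. *)
pose K k := [set w | exists w' y', [/\ F w' y',
  forall i, (i < k)%N -> (y' i <= m i)%N & forall i, (i < k)%N -> w' i = w i]].
exists K; split.
- move=> k; exists k => w w' ww' [w1 [y [Fy ym w1w]]]; exists w1, y; split=> // i ik.
  by rewrite w1w// ww'.
- move=> k w [w1 [y [Fy ym w1w]]]; exists w1, y; split=> // i ik.
    by apply: ym; rewrite ltnW.
  by apply: w1w; rewrite ltnW.
- move=> w Kw; rewrite EF /=.
  have /choice[wy wyP] : forall k, exists wy : (nat -> bool) * (nat -> nat),
      [/\ F wy.1 wy.2, forall i, (i < k)%N -> (wy.2 i <= m i)%N &
        forall i, (i < k)%N -> wy.1 i = w i].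
    by move=> k; have [w1 [y H]] := Kw k I; exists (w1, y).
  have [|z zP] := @konig_bounded (fun k => (wy k).2) m.
    by move=> k i ik; have [_ + _] := wyP k; apply.
  exists z; apply: cF => M; have [k Mk kz] := zP M.
  have [Fk _ wk] := wyP k; exists (wy k).1, (wy k).2; split=> // i iM.
  by split; [apply: wk; exact: leq_trans Mk|exact: kz].
- move=> k; apply: (lt_le_trans (Bm k)); apply: Cmono => w [y Fy ym].
  exists w, y; split=> // i ik; have := ym i.
  by rewrite size_mkseq nth_mkseq// => ->.
Qed.

(** * A capacity continuous from below *)

Section bounded_random_variables.
Context d (T : measurableType d) (R : realType) (P : probability T R).
Implicit Types f g : T -> R.

Definition bounded_rv f :=
  measurable_fun setT f /\ exists M, forall t, `|f t| <= M.

Lemma bounded_rv_cst (a : R) : bounded_rv (fun=> a).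
Proof. by split; [exact: measurable_cst|exists `|a|]. Qed.

Lemma bounded_rvD f g : bounded_rv f -> bounded_rv g ->
  bounded_rv (fun t => f t + g t).
Proof.
move=> [mf [M fM]] [mg [N gN]]; split; first exact: measurable_funD.
by exists (M + N) => t; rewrite (le_trans (ler_normD _ _))// lerD.
Qed.

Lemma bounded_rvM f g : bounded_rv f -> bounded_rv g ->
  bounded_rv (fun t => f t * g t).
Proof.
move=> [mf [M fM]] [mg [N gN]]; split; first exact: measurable_funM.
by exists (M * N) => t; rewrite normrM ler_pM.
Qed.

Lemma bounded_rvZ a f : bounded_rv f -> bounded_rv (fun t => a * f t).
Proof. exact/bounded_rvM/bounded_rv_cst. Qed.

Lemma bounded_rvB f g : bounded_rv f -> bounded_rv g ->
  bounded_rv (fun t => f t - g t).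
Proof.
move=> bf /(bounded_rvZ (-1)) bg; have := bounded_rvD bf bg.
by under [X in bounded_rv X]eq_fun do rewrite mulN1r.
Qed.

Lemma bounded_rv_norm f : bounded_rv f -> bounded_rv (fun t => `|f t|).
Proof.
move=> [mf [M fM]]; split; last by exists M => t; rewrite normr_id.
exact: measurableT_comp.
Qed.

Lemma bounded_rvX f : bounded_rv f -> bounded_rv (fun t => f t ^+ 2).
Proof.
by move=> bf; have := bounded_rvM bf bf; under [X in bounded_rv X]eq_fun do rewrite -expr2.
Qed.

Lemma bounded_rv_integrable f : bounded_rv f -> P.-integrable setT (EFin \o f).
Proof.
move=> [mf [M fM]]; apply: measurable_bounded_integrable => //.
  by rewrite [X in (X < _)%E]probability_setT ltry.
by exists M; split; [exact: num_real|move=> r Mr t _ /=; exact: le_trans (ltW Mr)].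
Qed.

Definition expect f := \int[P]_t f t.

Lemma EFin_expect f : bounded_rv f -> (expect f)%:E = (\int[P]_t (f t)%:E)%E.
Proof.
move=> bf; rewrite /expect /Rintegral fineK//.
exact/integrable_fin_num/bounded_rv_integrable.
Qed.

Lemma expectD f g : bounded_rv f -> bounded_rv g ->
  expect (fun t => f t + g t) = expect f + expect g.
Proof. by move=> bf bg; rewrite /expect RintegralD//; exact: bounded_rv_integrable. Qed.

Lemma expectB f g : bounded_rv f -> bounded_rv g ->
  expect (fun t => f t - g t) = expect f - expect g.
Proof. by move=> bf bg; rewrite /expect RintegralB//; exact: bounded_rv_integrable. Qed.

Lemma expectZ a f : bounded_rv f -> expect (fun t => a * f t) = a * expect f.
Proof. by move=> bf; rewrite /expect RintegralZl//; exact: bounded_rv_integrable. Qed.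

Lemma expect_ge0 f : (forall t, 0 <= f t) -> 0 <= expect f.
Proof. by move=> f0; apply: Rintegral_ge0. Qed.

Lemma le_expect f g : bounded_rv f -> bounded_rv g -> (forall t, f t <= g t) ->
  expect f <= expect g.
Proof. by move=> bf bg fg; apply: le_Rintegral => //; exact: bounded_rv_integrable. Qed.

Lemma expect_cst a : expect (fun=> a) = a.
Proof. by rewrite /expect Rintegral_cst//= probability_setT mulr1. Qed.

Lemma expect_indic A : measurable A -> (expect (\1_A))%:E = P A.
Proof.
move=> mA; rewrite EFin_expect; first by rewrite integral_indic// setIT.
split; first exact: measurable_indic.
by exists 1 => t; rewrite indicE; case: (_ \in _); rewrite ?normr1 ?normr0.
Qed.

(* AM-GM: 2 |f| <= s + f^2 / s. *)
Lemma expect_norm_le f s : 0 < s -> bounded_rv f ->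
  expect (fun t => `|f t|) <= (s + expect (fun t => f t ^+ 2) / s) / 2.
Proof.
move=> s0 bf.
rewrite -{1}[s]expect_cst mulrC -[expect _ / s]mulrC -expectZ; last exact: bounded_rvX.
have b1 := bounded_rvZ s^-1 (bounded_rvX bf).
rewrite -expectD//; last exact: bounded_rv_cst.
have b2 := bounded_rvD (bounded_rv_cst s) b1.
rewrite -expectZ//; apply: le_expect; [exact: bounded_rv_norm|exact: bounded_rvZ|].
move=> t; have -> : 2^-1 * (s + s^-1 * f t ^+ 2) = (s^-1 / 2) * (s ^+ 2 + `|f t| ^+ 2).
  rewrite -normrX (ger0_norm (sqr_ge0 _)); field; exact: lt0r_neq0.
rewrite [leLHS](_ : _ = (s^-1 / 2) * (2 * s * `|f t|)); last by field; exact: lt0r_neq0.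
apply: ler_wpM2l; first by rewrite mulr_ge0 ?invr_ge0// ltW.
have := sqr_ge0 (s - `|f t|); nra.
Qed.

End bounded_random_variables.

Section capacity.
Context d (T : measurableType d) (R : realType) (P : probability T R).
Context (Om : Type) (n : nat) (pr : 'I_n -> Om -> T).
Hypothesis n_gt0 : (0 < n)%N.
Implicit Types E A : set Om.

Definition covering E (phi : T -> R) :=
  [/\ measurable_fun setT phi, forall t, 0 <= phi t <= 1 &
      forall w, E w -> 1 <= \sum_(i < n) phi (pr i w)].

(* The square makes near-minimisers of an increasing sequence of sets Cauchy in
   L^2, by the parallelogram law, whence continuity from below. *)
Definition capacity E :=
  inf [set expect P (fun t => phi t ^+ 2) | phi in covering E].

Lemma covering_bounded E phi : covering E phi -> bounded_rv phi.
Proof.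
move=> [mphi phi01 _]; split=> //; exists 1 => t; have /andP[p0 p1] := phi01 t.
by rewrite ger0_norm.
Qed.

Lemma covering_sub E A phi : E `<=` A -> covering A phi -> covering E phi.
Proof. by move=> EA [mphi phi01 phiA]; split=> // w /EA /phiA. Qed.

Lemma covering1 E : covering E (fun=> 1).
Proof.
split; [exact: measurable_cst|by move=> t; rewrite ler01 lexx|move=> w _].
by rewrite sumr_const card_ord ler1n.
Qed.

Lemma has_inf_capacity E :
  has_inf [set expect P (fun t => phi t ^+ 2) | phi in covering E].
Proof.
split; first by eexists; exists (fun=> 1) => //; exact: covering1.
by exists 0 => _ [phi _ <-]; apply: expect_ge0 => t; exact: sqr_ge0.
Qed.

Lemma capacity_le E phi : covering E phi ->
  capacity E <= expect P (fun t => phi t ^+ 2).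
Proof. by move=> cE; apply: ge_inf; [case: (has_inf_capacity E)|exists phi]. Qed.

Lemma capacity_ge0 E : 0 <= capacity E.
Proof.
apply: lb_le_inf; first exact: (has_inf_capacity E).1.
by move=> _ [phi _ <-]; apply: expect_ge0 => t; exact: sqr_ge0.
Qed.

Lemma capacity_adherent E e : 0 < e ->
  exists2 phi, covering E phi & expect P (fun t => phi t ^+ 2) < capacity E + e.
Proof.
by move=> e0; have [_ [phi cE <-] ?] := inf_adherent e0 (has_inf_capacity E); exists phi.
Qed.

Lemma le_capacity E A : E `<=` A -> capacity E <= capacity A.
Proof.
move=> EA; apply: lb_le_inf; first exact: (has_inf_capacity A).1.
by move=> _ [phi cA <-]; apply/capacity_le/(covering_sub EA).
Qed.

Lemma covering_mean E phi psi : covering E phi -> covering E psi ->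
  covering E (fun t => 2^-1 * (phi t + psi t)).
Proof.
move=> [m1 b1 c1] [m2 b2 c2]; split.
- by apply: measurable_funM; [exact: measurable_cst|exact: measurable_funD].
- by move=> t; have := b1 t; have := b2 t; lra.
- move=> w Ew; rewrite -mulr_sumr big_split/=; have := c1 w Ew; have := c2 w Ew; lra.
Qed.

(** Parallelogram law: the mean of two coverings is a covering, so its quadratic value is at least
    [capacity E]. *)
Lemma covering_close E phi psi a b : covering E phi -> covering E psi ->
  expect P (fun t => phi t ^+ 2) <= capacity E + a ->
  expect P (fun t => psi t ^+ 2) <= capacity E + b ->
  expect P (fun t => (phi t - psi t) ^+ 2) <= 2 * a + 2 * b.
Proof.
move=> cphi cpsi ha hb.
have := capacity_le (covering_mean cphi cpsi).
have bphi := covering_bounded cphi; have bpsi := covering_bounded cpsi.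
have bm := covering_bounded (covering_mean cphi cpsi).
have -> : expect P (fun t => (phi t - psi t) ^+ 2) =
    2 * expect P (fun t => phi t ^+ 2) + 2 * expect P (fun t => psi t ^+ 2) -
    4 * expect P (fun t => (2^-1 * (phi t + psi t)) ^+ 2).
  have b1 := bounded_rvX bphi; have b2 := bounded_rvX bpsi.
  have b3 := bounded_rvX bm.
  rewrite -!expectZ// -expectD; [|exact: bounded_rvZ|exact: bounded_rvZ].
  rewrite -expectB; [|by apply: bounded_rvD; exact: bounded_rvZ|exact: bounded_rvZ].
  by congr expect; apply/funext => t; field.
lra.
Qed.

Lemma covering_sups (E : nat -> set Om) phi : (forall k, covering (E k) (phi k)) ->
  covering (\bigcup_k E k) (fun t => sups (phi ^~ t) 0).
Proof.
move=> cE; have ub t : has_ubound [set phi k t | k in [set: nat]].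
  by exists 1 => _ [k _ <-]; have [_ /(_ t)/andP[]] := cE k.
have le_sups k t : phi k t <= sups (phi ^~ t) 0.
  by apply: sup_ubound; [have [M hM] := ub t; exists M => _ [j _ <-]; apply: hM; exists j|exists k].
split.
- by apply: measurable_fun_sups => [t _|k]; [exact: ub|case: (cE k)].
- move=> t; apply/andP; split.
    by apply: (le_trans _ (le_sups 0%N t)); have [_ /(_ t)/andP[]] := cE 0%N.
  apply: sup_le_ub; first by exists (phi 0%N t), 0%N.
  by move=> _ [k _ <-]; have [_ /(_ t)/andP[]] := cE k.
- move=> w [k _ Ew]; have [_ _ /(_ w Ew)] := cE k => /le_trans; apply.
  by apply: ler_sum => i _.
Qed.

(** The supremum exceeds [phi 0] by at most the sum [S] of the absolute increments, and for values
    in [0, 1] a difference of squares is at most twice the difference. *)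
Lemma expect_sups_sqr_le (phi : nat -> T -> R) e :
  (forall k, bounded_rv (phi k)) -> (forall k t, 0 <= phi k t <= 1) -> 0 <= e ->
  (forall k, expect P (fun t => `|phi k.+1 t - phi k t|) <= e / (2 ^ k.+1)%:R) ->
  expect P (fun t => sups (phi ^~ t) 0 ^+ 2) <=
  expect P (fun t => phi 0%N t ^+ 2) + 2 * e.
Proof.
move=> bphi phi01 e0 dphi; set psi := fun t => sups (phi ^~ t) 0.
(* Covering empty sets is vacuous; this extracts only the measurability and the bounds of the
   supremum. *)
have [mpsi psi01 _] : covering (\bigcup_(k : nat) set0) psi.
  by apply: (@covering_sups (fun=> set0)) => k; split=> //; exact: (bphi k).1.
have bpsi : bounded_rv psi.
  by split=> //; exists 1 => t; have /andP[p0 p1] := psi01 t; rewrite ger0_norm.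
pose D k t := `|phi k.+1 t - phi k t|.
have bD k : bounded_rv (D k) by apply/bounded_rv_norm/bounded_rvB.
pose S t : \bar R := (\sum_(0 <= k <oo) (D k t)%:E)%E.
have S0 t : (0 <= S t)%E by apply: nneseries_ge0 => k _ _; rewrite lee_fin /D.
have psiS t : ((psi t ^+ 2)%:E <= (phi 0%N t ^+ 2)%:E + 2%:E * S t)%E.
  have phiS k : ((phi k t)%:E <= (phi 0%N t)%:E + S t)%E.
    apply: (@le_trans _ _ ((phi 0%N t)%:E + \sum_(0 <= j < k) (D j t)%:E)%E); last first.
      by apply: leeD => //; apply: nneseries_lim_ge => j _ _; rewrite lee_fin /D.
    elim: k => [|k IH]; first by rewrite big_geq// adde0.
    rewrite big_nat_recr//= addeA; apply: le_trans (leeD IH (lexx _)).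
    by rewrite -EFinD lee_fin /D; have := ler_norm (phi k.+1 t - phi k t); lra.
  case: (S t) (S0 t) phiS => [r|_ _|//]; last first.
    by rewrite gt0_muley ?lte_fin// addey// leey.
  move=> r0 phir; rewrite -EFinM -EFinD lee_fin.
  have psir : psi t <= phi 0%N t + r.
    apply: sup_le_ub; first by exists (phi 0%N t), 0%N.
    by move=> _ [k _ <-]; rewrite -lee_fin EFinD.
  have /andP[p0 p1] := phi01 0%N t; have /andP[q0 q1] := psi01 t.
  rewrite lee_fin in r0.
  have [ge|lt] := leP (phi 0%N t) (psi t); nra.
rewrite -lee_fin EFinD !EFin_expect; [|exact: bounded_rvX|exact: bounded_rvX].
have mS : measurable_fun setT S.
  apply: ge0_emeasurable_sum => [k t _ _|k _]; first by rewrite lee_fin /D.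
  by apply/measurable_EFinP; exact: (bD k).1.
have mphi : measurable_fun setT (fun t => (phi 0%N t ^+ 2)%:E).
  by apply/measurable_EFinP; exact: (bounded_rvX (bphi 0%N)).1.
have m2S : measurable_fun setT (fun t => 2%:E * S t)%E.
  by apply: emeasurable_funM => //; exact: measurable_cst.
apply: (@le_trans _ _ (\int[P]_t ((phi 0%N t ^+ 2)%:E + 2%:E * S t))%E).
  apply: ge0_le_integral => //.
  - by move=> t _; rewrite lee_fin sqr_ge0.
  - by apply/measurable_EFinP; exact: (bounded_rvX bpsi).1.
  - exact: emeasurable_funD.
  - by move=> t _; exact: psiS.
rewrite ge0_integralD//; last 2 first.
  by move=> t _; rewrite lee_fin sqr_ge0.
  by move=> t _; rewrite mule_ge0.
rewrite ge0_integralZl// leeD2l// EFinM lee_pmul2l// integral_nneseries//; last 2 first.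
  by move=> k; apply/measurable_EFinP; exact: (bD k).1.
  by move=> k t _; rewrite lee_fin /D.
apply: le_trans (epsilon_trick0 xpredT e0).
apply: lee_nneseries => [k _ _|k _].
  by apply: integral_ge0 => t _; rewrite lee_fin /D.
by rewrite -EFin_expect// lee_fin; exact: dphi.
Qed.

Lemma capacity_bigcup (A : nat -> set Om) delta :
  (forall k, A k `<=` A k.+1) -> (forall k, capacity (A k) <= delta) ->
  capacity (\bigcup_k A k) <= delta.
Proof.
move=> ndA Adelta; apply/ler_addgt0Pr => eps eps0.
have homoA i j : (i <= j)%N -> A i `<=` A j.
  move=> ij; rewrite -(subnK ij); elim: (j - i)%N => [//|k IH].
  exact: subset_trans IH (ndA _).
(* The total error is [9 * e] from the increments plus [t 0 ^+ 2 = e ^+ 2 / 4] from the first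
   covering, below [10 * e] because [e <= 1]. *)
pose e := Num.min 1 (eps / 10).
have e0 : 0 < e by rewrite lt_min ltr01 divr_gt0.
have e1 : e <= 1 by rewrite ge_min lexx.
have e10 : 10 * e <= eps.
  have : e <= eps / 10 by rewrite ge_min lexx orbT.
  lra.
pose t k := e / (2 ^ k.+1)%:R.
have t0 k : 0 < t k by rewrite divr_gt0// ltr0n expn_gt0.
have tS k : t k.+1 = t k / 2 by rewrite /t [(2 ^ k.+2)%N]expnSr natrM invfM mulrA.
have supA : has_sup [set capacity (A k) | k in [set: nat]].
  by split; [exists (capacity (A 0%N)), 0%N|exists delta => _ [k _ <-]].
pose s := sup [set capacity (A k) | k in [set: nat]].
have sdelta : s <= delta.
  by apply: sup_le_ub; [case: supA|move=> _ [k _ <-]].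
have As k : capacity (A k) <= s by apply: sup_ubound; [case: supA|exists k].
have /choice[N NP] : forall k, exists N, (k <= N)%N /\ s - t k ^+ 2 < capacity (A N).
  move=> k; have tk2 : 0 < t k ^+ 2 by rewrite exprn_gt0.
  have [_ [j _ <-] sj] := sup_adherent tk2 supA.
  exists (maxn k j); rewrite leq_maxl; split=> //; apply: (lt_le_trans sj).
  by apply: le_capacity; apply: homoA; exact: leq_maxr.
have /choice[phi phiP] : forall k, exists phi, covering (A (N k)) phi /\
    expect P (fun x => phi x ^+ 2) < capacity (A (N k)) + t k ^+ 2.
  move=> k; have tk2 : 0 < t k ^+ 2 by rewrite exprn_gt0.
  by have [phi c1 c2] := capacity_adherent (A (N k)) tk2; exists phi.
have bphi k : bounded_rv (phi k) by exact: covering_bounded (phiP k).1.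
(* The squared L^2 distance is at most [8 * t k ^+ 2]; [expect_norm_le] with [s := t k] then gives
   [(t k + 8 * t k) / 2], whence the factor 9/2. *)
have close k : expect P (fun x => `|phi k.+1 x - phi k x|) <= (9 / 2 * e) / (2 ^ k.+1)%:R.
  (* [N] need not be monotone, so both functions are compared as coverings of the smaller set, whose
     capacity is still within [t k ^+ 2] of [s]. *)
  pose M := minn (N k) (N k.+1).
  have sM : s - t k ^+ 2 < capacity (A M).
    rewrite /M /minn; case: ifP => _; first exact: (NP k).2.
    apply: le_lt_trans (NP k.+1).2; rewrite tS; have := sqr_ge0 (t k); lra.
  have c1 := covering_sub (homoA _ _ (geq_minl (N k) (N k.+1))) (phiP k).1.
  have c2 := covering_sub (homoA _ _ (geq_minr (N k) (N k.+1))) (phiP k.+1).1.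
  have := @covering_close _ _ _ (2 * t k ^+ 2) (2 * t k ^+ 2) c2 c1.
  have tS2 : t k.+1 ^+ 2 <= t k ^+ 2 by rewrite tS; have := sqr_ge0 (t k); lra.
  have h1 := (phiP k).2; have h2 := (phiP k.+1).2.
  have h3 := As (N k); have h4 := As (N k.+1).
  move=> /(_ ltac:(lra) ltac:(lra)) h5.
  apply: (le_trans (expect_norm_le P (t0 k) (bounded_rvB (bphi _) (bphi _)))).
  have : expect P (fun x => (phi k.+1 x - phi k x) ^+ 2) / t k <= 8 * t k.
    by rewrite ler_pdivrMr// -mulrA -expr2; lra.
  by rewrite -mulrA -/(t k); lra.
have e90 : 0 <= 9 / 2 * e by rewrite mulr_ge0// ltW.
have := expect_sups_sqr_le bphi (fun k => let: And3 _ h _ := (phiP k).1 in h) e90 close.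
have := capacity_le (covering_sups (fun k => (phiP k).1)).
have : capacity (\bigcup_k A k) <= capacity (\bigcup_k A (N k)).
  apply: le_capacity => w [k _ Akw]; exists k => //.
  exact: (homoA _ _ (NP k).1) Akw.
have := (phiP 0%N).2; have := As (N 0%N).
have -> : t 0%N = e / 2 by [].
by have : e ^+ 2 <= e by [rewrite expr2 ler_piMl// ltW]; lra.
Qed.

(** Borel-Cantelli. Some coordinate of each tuple carries at least [1/n] of a covering, and
    Chebyshev bounds the measure of the points where [phi k] is that large by [2^-(k+1)]. Were all
    coordinates of a tuple outside the upper limit of these sets, a late covering would sum to less
    than 1 on it. *)
Lemma capacity0_null E : capacity E = 0 -> exists A : set T,
  [/\ measurable A, P A = 0%E & forall w, E w -> exists i, A (pr i w)].
Proof.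
move=> cE0; have n0 : 0 < n%:R :> R by rewrite ltr0n.
have e0 k : 0 < n%:R ^- 2 / (2 ^ k.+1)%:R :> R.
  by rewrite divr_gt0 ?invr_gt0 ?exprn_gt0// ltr0n expn_gt0.
have /choice[phi phiP] : forall k, exists phi, covering E phi /\
    expect P (fun x => phi x ^+ 2) < n%:R ^- 2 / (2 ^ k.+1)%:R.
  move=> k; have [phi c1 c2] := capacity_adherent E (e0 k).
  by exists phi; rewrite cE0 add0r in c2.
pose B k := [set t | n%:R^-1 <= phi k t].
have mB k : measurable (B k).
  have [mphi _ _] := (phiP k).1.
  rewrite -[B k]setTI; have -> : B k = phi k @^-1` `[n%:R^-1, +oo[.
    by apply/seteqP; split=> t /=; rewrite in_itv/= andbT.
  exact: mphi.
have PB k : (P (B k) <= (1 / (2 ^ k.+1)%:R)%:E)%E.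
  rewrite -expect_indic// lee_fin.
  have b := covering_bounded (phiP k).1.
  apply: (@le_trans _ _ (expect P (fun t => n%:R ^+ 2 * phi k t ^+ 2))).
    apply: le_expect; last 1 first.
    - move=> t; rewrite indicE; case: (boolP (t \in B k)) => [|_].
        rewrite inE /B/= => Bt; rewrite -exprMn exprn_ege1//.
        by rewrite -ler_pdivrMl// mulr1.
      by rewrite mulr_ge0// sqr_ge0.
    - split; first exact: measurable_indic.
      by exists 1 => t; rewrite indicE; case: (_ \in _); rewrite ?normr1 ?normr0.
    - exact/bounded_rvZ/bounded_rvX.
  rewrite expectZ; last exact: bounded_rvX.
  by rewrite -ler_pdivlMl ?exprn_gt0// mul1r; exact/ltW/(phiP k).2.
exists (lim_sup_set B); split.
- by apply: bigcap_measurable => // k _; apply: bigcup_measurable.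
- apply: lim_sup_set_cvg0 => //.
  apply: (@le_lt_trans _ _ (\sum_(0 <= k <oo) (1 / (2 ^ k.+1)%:R)%:E)%E).
    by apply: lee_nneseries => [k _ _|k _]; [exact: measure_ge0|exact: PB].
  exact: le_lt_trans (epsilon_trick0 xpredT ler01) (ltry _).
- move=> w Ew; apply: contrapT => /forallNP nA.
  have /choice[K KP] : forall i, exists k, forall j, (k <= j)%N -> phi j (pr i w) < n%:R^-1.
    move=> i; have /existsNP[k /not_implyP[_ nB]] := nA i; exists k => j kj.
    by rewrite ltNge; apply/negP => Bj; apply: nB; exists j.
  pose j := \max_(i < n) K i; have [_ _ /(_ w Ew)] := (phiP j).1.
  apply/negP; rewrite -ltNge.
  have lt i : phi j (pr i w) < n%:R^-1 by apply: KP; exact: leq_bigmax.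
  apply: (@lt_le_trans _ _ (\sum_(i < n) n%:R^-1 : R)).
    apply: ltr_sum => //; apply/hasP.
    by exists (Ordinal n_gt0); rewrite ?mem_index_enum.
  by rewrite sumr_const card_ord -[n%:R^-1 *+ n]mulr_natl divff// gt_eqF.
Qed.

End capacity.

(** * Kellerer's alternative for null sets *)

Section kellerer.
Context (R : realType) (rho : probability bitstream R) (n : nat).
Context (pr : 'I_n -> (nat -> bool) -> bitstream).
Hypothesis n_gt0 : (0 < n)%N.
Hypothesis clopens_pr : forall i A, clopens A -> clopens (pr i @^-1` A).

Section dual_functional.
Context (K : nat -> set (nat -> bool)) (delta : R).
Hypothesis K_decr : forall k, K k.+1 `<=` K k.
Hypothesis K_capacity : forall k, delta < capacity rho pr (K k).

Local Notation V := {fimfun (nat -> bool) >-> R}.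
Implicit Types f g : V.

(** Domination on a single [K j], rather than on the intersection, lets the capacity bound for [K j]
    apply, and still gives [p] the value 0 on the indicator of the complement of each [K j]. *)
Let dominates f (phi : bitstream -> R) :=
  [/\ bounded_rv phi, forall t, 0 <= phi t &
    exists j, forall w, K j w -> f w <= \sum_(i < n) phi (pr i w)].

Let p f := inf [set expect rho phi | phi in dominates f].

Let K_le i j : (i <= j)%N -> K j `<=` K i.
Proof.
move=> ij; rewrite -(subnK ij); elim: (j - i)%N => [//|k IH].
by rewrite addSn; apply: subset_trans IH; exact: K_decr.
Qed.

Let has_inf_p f : has_inf [set expect rho phi | phi in dominates f].
Proof.
split; last by exists 0 => _ [phi [_ phi0 _] <-]; exact: expect_ge0.
have /finite_seqP[s sE] := @fimfunP _ _ f.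
pose M := \sum_(x <- s) `|x|.
have M0 : 0 <= M by apply: sumr_ge0.
exists (expect rho (fun=> M)), (fun=> M) => //; split=> //; first exact: bounded_rv_cst.
exists 0%N => w _; rewrite sumr_const card_ord.
have fs : f w \in s by have : range f (f w) by [exists w]; rewrite sE.
apply: (@le_trans _ _ M); last by rewrite -[M *+ n]mulr_natr ler_peMr// ler1n.
rewrite /M (big_rem _ fs)/= (le_trans (ler_norm _))// lerDl.
exact: sumr_ge0.
Qed.

Let p_le f phi : dominates f phi -> p f <= expect rho phi.
Proof. by move=> fphi; apply: ge_inf; [case: (has_inf_p f)|exists phi]. Qed.

Let p_ge0 f : 0 <= p f.
Proof.
apply: lb_le_inf; first exact: (has_inf_p f).1.
by move=> _ [phi [_ phi0 _] <-]; exact: expect_ge0.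
Qed.

Let fimfunMn f k w : (f *+ k) w = f w *+ k.
Proof.
elim: k => [|k IH]; first by rewrite !mulr0n.
by rewrite !mulrS -IH.
Qed.

Let sublinear_p : sublinear p.
Proof.
split=> [f g|f [|k]]; last 2 first.
- by rewrite mulr0n; exact: p_ge0.
- apply: lb_le_inf; first exact: (has_inf_p _).1.
  move=> _ [phi [bphi phi0 [j fphi]] <-].
  have k0 : 0 < k.+1%:R :> R by rewrite ltr0n.
  rewrite -mulr_natl -ler_pdivlMl// -expectZ//; apply: p_le; split.
  + exact: bounded_rvZ.
  + by move=> t; rewrite mulr_ge0// invr_ge0 ltW.
  + exists j => w /fphi; rewrite fimfunMn -mulr_sumr ler_pdivlMl//.
    by rewrite mulr_natl.
- apply/ler_addgt0Pr => e e0; have e20 : 0 < e / 2 by rewrite divr_gt0.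
  have [_ [phi [b1 p1 [j1 d1]] <-] l1] := inf_adherent e20 (has_inf_p f).
  have [_ [psi [b2 p2 [j2 d2]] <-] l2] := inf_adherent e20 (has_inf_p g).
  have : p (f + g) <= expect rho (fun t => phi t + psi t).
    apply: p_le; split; first exact: bounded_rvD.
      by move=> t; rewrite addr_ge0.
    exists (maxn j1 j2) => w Kw; rewrite big_split/= lerD//.
      by apply: d1; apply: K_le Kw; exact: leq_maxl.
    by apply: d2; apply: K_le Kw; exact: leq_maxr.
  rewrite expectD// -/(p f) -/(p g) in l1 l2 *; lra.
Qed.

(** The passage from the quadratic to the linear value: a dominating function truncated at 1 is a
    covering, and its square lies below it. *)
Let delta_le_p1 : delta <= p (@indic_fimfun (nat -> bool) R setT).
Proof.
apply: lb_le_inf; first exact: (has_inf_p _).1.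
move=> _ [phi [[mphi bphi] phi0 [j fphi]] <-].
have cK : covering pr (K j) (fun t => Num.min (phi t) 1).
  split.
  - by apply: measurable_minr => //; exact: measurable_cst.
  - by move=> t; rewrite le_min phi0 ler01/= ge_min lexx orbT.
  - move=> w /fphi; rewrite /= indicE in_setT.
    have [[i i1] _|/forallNP n1] := pselect (exists i, 1 <= phi (pr i w)).
      rewrite (bigD1 i)//= min_r// lerDl; apply: sumr_ge0 => k _.
      by rewrite le_min phi0 ler01.
    move=> /le_trans; apply; apply: ler_sum => i _.
    by rewrite min_l// ltW// ltNge; apply/negP.
apply: (le_trans (ltW (K_capacity j))); apply: (le_trans (capacity_le rho n_gt0 cK)).
have bmin := covering_bounded cK.
apply: le_expect; [exact: bounded_rvX|by split|].
move=> t; have [_ /(_ t)/andP[m0 m1] _] := cK.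
by apply: (@le_trans _ _ (Num.min (phi t) 1)); [rewrite expr2 ler_piMl|rewrite ge_min lexx].
Qed.

(** The functional is bounded by [p], so each estimate is an upper bound of [p] by an explicit
    dominating function: 0 for positivity and for the complements of the [K j], the indicator of [A]
    for the marginals. [lam] is only finitely additive, but on all subsets. *)
Lemma dual_content : exists lam : set (nat -> bool) -> R,
  [/\ (forall A, 0 <= lam A),
      (forall A B, A `&` B = set0 -> lam (A `|` B) = lam A + lam B),
      delta <= lam setT,
      (forall j, lam (~` K j) = 0) &
      (forall A : set bitstream, measurable A ->
         \sum_(i < n) lam (pr i @^-1` A) <= expect rho (\1_A))].
Proof.
have [L [LD Lp L1]] := hahn_banach_additive (@indic_fimfun (nat -> bool) R setT) sublinear_p.
have L0 : L 0 = 0 by have := LD 0 0; rewrite addr0; lra.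
have LN f : L (- f) = - L f by have := LD f (- f); rewrite subrr L0; lra.
have Lind_ge0 A : 0 <= L (@indic_fimfun (nat -> bool) R A).
  have := Lp (- @indic_fimfun (nat -> bool) R A); rewrite LN.
  have : p (- @indic_fimfun (nat -> bool) R A) <= expect rho (fun=> 0).
    apply: p_le; split=> //; first exact: bounded_rv_cst.
    by exists 0%N => w _; rewrite big1// fimfunN/= indicE oppr_le0.
  by rewrite expect_cst => pA LA; rewrite -oppr_le0; exact: le_trans LA pA.
exists (fun A => L (@indic_fimfun (nat -> bool) R A)); split.
- exact: Lind_ge0.
- move=> A B AB0; rewrite -LD; congr L; apply/fimfuneqP => w.
  rewrite fimfunD/= !indicE in_setU.
  case: (boolP (w \in A)); case: (boolP (w \in B)); rewrite ?addr0 ?add0r//.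
  by rewrite !inE => Bw Aw; have : (A `&` B) w by []; rewrite AB0.
- exact: le_trans delta_le_p1 L1.
- move=> j; apply/eqP; rewrite eq_le Lind_ge0 andbT.
  apply: (le_trans (Lp _)); rewrite -(expect_cst rho 0); apply: p_le; split=> //.
    exact: bounded_rv_cst.
  exists j => w Kw; rewrite big1//= indicE.
  by case: (boolP (w \in ~` K j)) => //; rewrite inE.
- move=> A mA; rewrite -(big_morph L LD L0); apply: (le_trans (Lp _)).
  apply: p_le; split.
  + split; first exact: measurable_indic.
    by exists 1 => t; rewrite indicE; case: (_ \in _); rewrite ?normr1 ?normr0.
  + by move=> t; rewrite indicE.
  + by exists 0%N => w _; rewrite fimfun_sum; apply: ler_sum => i _; rewrite /= !indicE.
Qed.

End dual_functional.

Theorem kellerer_null (E : set bitstream) : measurable E ->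
  (exists A : set bitstream, [/\ measurable A, rho A = 0%E &
     forall w, E w -> exists i, A (pr i w)]) \/
  (exists lam sig : {measure set bitstream -> \bar R},
     [/\ lam (~` E) = 0%E, (0 < lam setT)%E &
       forall A, measurable A ->
         rho A = (sig A + \sum_(i < n) lam (pr i @^-1` A))%E]).
Proof.
move=> mE; have [cE|] := ltP 0 (capacity rho pr E); last first.
  move=> cE0; left; apply: (capacity0_null (P := rho) n_gt0).
  by apply/eqP; rewrite eq_le cE0 capacity_ge0.
right; pose delta := capacity rho pr E / 2.
have d0 : 0 < delta by rewrite divr_gt0.
have dE : delta < capacity rho pr E by rewrite /delta; lra.
have [|K [cK dK KE dCK]] := choquet_capacitability (le_capacity rho pr n_gt0) _ mE dE.
  by move=> A ndA; exact: capacity_bigcup.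
have [l [l0 lU ldelta lK lrho]] := dual_content dK dCK.
have [lam lamE] : exists lam : {measure set bitstream -> \bar R},
    forall A, clopens A -> lam A = (l A)%:E.
  by apply: clopen_content_measure => [A _|A B _ _]; [exact: l0|exact: lU].
pose s A := expect rho (\1_A) - \sum_(i < n) l (pr i @^-1` A).
have [sig sigE] : exists sig : {measure set bitstream -> \bar R},
    forall A, clopens A -> sig A = (s A)%:E.
  apply: clopen_content_measure => [A cA|A B cA cB AB0].
    by rewrite subr_ge0; apply: lrho; exact: clopens_measurable.
  rewrite /s (eq_bigr (fun i => l (pr i @^-1` A) + l (pr i @^-1` B))); last first.
    by move=> i _; rewrite preimage_setU lU// -preimage_setI AB0 preimage_set0.
  have -> : expect rho (\1_(A `|` B)) = expect rho (\1_A) + expect rho (\1_B).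
    apply: EFin_inj; rewrite EFinD !expect_indic; last 3 first.
      exact: clopens_measurable.
      exact: clopens_measurable.
      by apply: clopens_measurable; exact: clopensU.
    by rewrite measureU//; exact: clopens_measurable.
  by rewrite big_split/= opprD addrACA.
exists lam, sig; split.
(* The complement of [E] lies in the union of the complements of the [K j]; these are clopen, so
   [lam] agrees there with [l], which vanishes. *)
- apply: measure_negligible; first exact: measurableC.
  have CE : ~` E `<=` \bigcup_j ~` K j by rewrite -setC_bigcap; exact: subsetC.
  apply: negligibleS CE _; apply: negligible_bigcup => j; have cCK := clopensC (cK j).
  apply/negligibleP; first exact: clopens_measurable.
  by have := lamE _ cCK; rewrite lK.
- by rewrite lamE ?lte_fin; [exact: lt_le_trans ldelta|exact: clopensT].
- have mpr i : measurable_fun setT (pr i : bitstream -> bitstream).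
    apply: (@measurability _ _ bitstream bitstream setT (pr i) clopens) => // _ [A cA <-].
    by rewrite setTI; apply: clopens_measurable; exact: clopens_pr.
  have /choice[m mP] i := pushforward_measure lam (mpr i).
  have [M [ME _]] := sum_measure m.
  have rhoE A : clopens A -> rho A = measure_add sig M A.
    move=> cA; rewrite [RHS]measure_addE ME sigE//.
    rewrite (eq_bigr (fun i => (l (pr i @^-1` A))%:E)); last first.
      by move=> i _; rewrite (mP i).1 lamE//; exact: clopens_pr.
    rewrite sumEFin -EFinD subrK expect_indic//; exact: clopens_measurable.
  move=> A mA; rewrite (bitstream_measure_unique _ rhoE mA).
    by rewrite [LHS]measure_addE ME; congr adde; apply: eq_bigr => i _; rewrite (mP i).1.
  by rewrite [X in (X < _)%E]probability_setT ltry.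
Qed.

End kellerer.

(** * Borel retracts of the Cantor space *)

Lemma measurable_exists d (T : measurableType d) (I : countType) (F : I -> set T) :
  (forall i, measurable (F i)) -> measurable [set w | exists i, F i w].
Proof.
move=> mF; have -> : [set w | exists i, F i w] = \bigcup_i F i.
  by apply/seteqP; split=> w [i]; [exists i|exists i].
exact: countable_bigcupT_measurable.
Qed.

Lemma measurable_forall d (T : measurableType d) (I : countType) (F : I -> set T) :
  (forall i, measurable (F i)) -> measurable [set w | forall i, F i w].
Proof.
move=> mF; have -> : [set w | forall i, F i w] = ~` [set w | exists i, (~` F i) w].
  by apply/seteqP; split=> w /=; [move=> Fw [i]; apply|move/forallNP => nF i; exact: contrapT].
by apply: measurableC; apply: measurable_exists => i; exact: measurableC.
Qed.

Lemma measurable_reindex (h : nat -> nat) :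
  measurable_fun setT (fun w : bitstream => (fun i => w (h i)) : bitstream).
Proof. by apply: measurable_fun_bitstream => k; exact: measurable_bit. Qed.

(** A total [g] lets costs and sets be pulled back to every bitstream, whatever the range of
    [tau]. *)
Definition borel_retract d (T : measurableType d) :=
  exists (tau : T -> bitstream) (g : bitstream -> T),
    [/\ measurable_fun setT tau, measurable_fun setT g & cancel tau g].

Lemma borel_retract_prod d1 d2 (T1 : measurableType d1) (T2 : measurableType d2) :
  borel_retract T1 -> borel_retract T2 -> borel_retract (T1 * T2)%type.
Proof.
move=> [tau1 [g1 [mtau1 mg1 K1]]] [tau2 [g2 [mtau2 mg2 K2]]].
exists (fun z q => if odd q then tau2 z.2 q./2 else tau1 z.1 q./2),
  (fun w => (g1 (fun i => w i.*2), g2 (fun i => w i.*2.+1))); split.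
- apply: measurable_fun_bitstream => q; case: (odd q).
    have := measurableT_comp mtau2 (@measurable_snd _ _ T1 T2).
    by move=> /(_ measurableT _ (measurable_bit q./2)); rewrite setTI.
  have := measurableT_comp mtau1 (@measurable_fst _ _ T1 T2).
  by move=> /(_ measurableT _ (measurable_bit q./2)); rewrite setTI.
- apply: measurable_fun_pair.
    exact: measurableT_comp mg1 (measurable_reindex double).
  exact: measurableT_comp mg2 (measurable_reindex (fun i => i.*2.+1)).
- move=> [x y] /=; congr pair.
    rewrite -[RHS]K1; congr g1; apply/funext => i.
    by rewrite odd_double doubleK.
  rewrite -[RHS]K2; congr g2; apply/funext => i.
  by rewrite /= odd_double /= uphalf_double.
Qed.

(* A point is coded by the set of pairs (m, k) such that it lies within 1/(m+1)
   of the k-th point of a dense sequence. *)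
Lemma polish_borel_retract (R : realType) (T : ptopologicalType) :
  polish_space R T -> borel_retract (borel T).
Proof.
move=> [[D cD dD] [d [[d0 dC dT] nbhsd complete]]].
have dxx x : d x x = 0 by apply/d0.
have d_ge0 x y : 0 <= d x y by have := dT x y x; rewrite dxx (dC y x); lra.
have [e eP] : exists e : nat -> T, forall x r, 0 < r -> exists k, d x (e k) < r.
  have ex x r : 0 < r -> exists2 y, D y & d x y < r.
    move=> r0; have [] := dD [set y | d x y < r]; last by move=> y [/= ? ?]; exists y.
      by exists x; rewrite /= dxx.
    rewrite openE => y /= xy; apply/nbhsd; exists (r - d x y); first by rewrite subr_gt0.
    by move=> z /= yz; have := dT x y z; lra.
  have /pfcard_geP[D0|/unsquash f] := cD.
    by have [y] := ex point 1 ltr01; rewrite D0.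
  exists f => x r r0; have [y Dy xy] := ex x r r0.
  by have [k _ fk] := 'surj_f Dy; exists k; rewrite fk.
pose r (m : nat) : R := m.+1%:R^-1.
have r0 m : 0 < r m by rewrite invr_gt0.
have r_le i j : (i <= j)%N -> r j <= r i by move=> ij; rewrite lef_pV2 ?posrE// ler_nat ltnS.
have rle a : 0 < a -> exists m, 2 * r m < a.
  move=> a0; have /ltr_add_invr[m] : 0 < a / 2 by rewrite divr_gt0.
  by rewrite add0r => ma; exists m; rewrite mulrC -ltr_pdivlMr.
clearbody r; pose W (w : bitstream) (m k : nat) := w (pickle (m, k)).
(* Countably many conditions on bits, hence measurable, yet they force centres chosen at successive
   scales to be Cauchy; exactly one point then lies in all the closed balls listed by [w]. *)
pose good := [set w : bitstream | (forall m, exists k, W w m k) /\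
  (forall q : (nat * nat) * (nat * nat), W w q.1.1 q.1.2 -> W w q.2.1 q.2.2 ->
    d (e q.1.2) (e q.2.2) < r q.1.1 + r q.2.1)].
pose L w := [set l | forall m k, W w m k -> d (e k) l <= r m].
have L_good w : good w -> exists l, L w l.
  move=> [/choice[k Wk] Wd].
  have [|l ul] := complete (fun m => e (k m)).
    move=> a /rle[m ma]; exists m => i j mi mj.
    have := Wd ((i, k i), (j, k j)) (Wk i) (Wk j) => /=.
    have ri := r_le _ _ mi; have rj := r_le _ _ mj.
    lra.
  exists l => m j Wmj; apply/ler_addgt0Pr => a a0.
  have a20 : 0 < a / 2 by rewrite divr_gt0.
  have nbl : nbhs l [set y | d l y < a / 2] by apply/nbhsd; exists (a / 2).
  have [N _ NP] := ul _ nbl.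
  have [M Ma] := rle a a0; pose i := maxn N M.
  have := Wd ((m, j), (i, k i)) Wmj (Wk i); have /= := NP i (leq_maxl _ _).
  have ri : r i <= r M by apply: r_le; exact: leq_maxr.
  by have := dT (e j) (e (k i)) l; rewrite (dC (e (k i)) l) /=; lra.
have L_uniq w l l' : good w -> L w l -> L w l' -> l = l'.
  move=> [Wk _] Ll Ll'; apply/d0/eqP; rewrite eq_le d_ge0 andbT.
  apply/ler_addgt0Pr => a /rle[m ma]; have [k wk] := Wk m.
  have := Ll _ _ wk; have := Ll' _ _ wk; have := dT l (e k) l'.
  by rewrite (dC l (e k)); lra.
pose g w : borel T := if pselect (good w) then xget point (L w) else point.
pose tau (x : borel T) : bitstream :=
  fun q => if unpickle q is Some (m, k) then d x (e k) < r m else false.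
have Wtau x m k : W (tau x) m k = (d x (e k) < r m) by rewrite /W /tau pickleK.
have good_tau x : good (tau x).
  split=> [m|[[m k] [m' k']]]; last first.
    by rewrite !Wtau /=; have := dT (e k) x (e k'); rewrite (dC (e k) x); lra.
  by have [k xk] := eP x _ (r0 m); exists k; rewrite Wtau.
have L_tau x : L (tau x) x by move=> m k; rewrite Wtau dC; exact: ltW.
have gL w : good w -> L w (g w).
  by move=> gw; rewrite /g; case: pselect => //= gw'; have [l] := L_good w gw; exact: xgetI.
have mgood : measurable good.
  apply: measurableI.
    apply: measurable_forall => m; apply: measurable_exists => k.
    exact: measurable_bit.
  apply: measurable_forall => q.
  have [dq|dq] := boolP (d (e q.1.2) (e q.2.2) < r q.1.1 + r q.2.1).
    by rewrite [X in measurable X](_ : _ = setT)//; apply/seteqP; split.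
  rewrite [X in measurable X](_ : _ = ~` ([set w | W w q.1.1 q.1.2] `&` [set w | W w q.2.1 q.2.2])).
    by apply: measurableC; apply: measurableI; exact: measurable_bit.
  apply/seteqP; split=> w /=; first by move=> H [w1 w2]; have := H w1 w2.
  by move=> H w1 w2; case: H.
exists tau, g; split.
- apply: measurable_fun_bitstream => q; rewrite /tau.
  case: (unpickle q) => [[m k]|]; last first.
    by rewrite (_ : [set _ | _] = set0)//; apply/seteqP; split.
  apply: sub_sigma_algebra; rewrite openE => x /= xk; apply/nbhsd.
  exists (r m - d x (e k)); first by rewrite subr_gt0.
  by move=> y /= xy; have := dT y x (e k); rewrite (dC y x); lra.
- apply: (@measurability _ _ bitstream (borel T) setT g open) => // _ [U oU <-].
  rewrite setTI.
  (* For a good code, [g w] lies in the open set [U] exactly when some closed ball listed by [w] is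
     contained in [U]. Codes that are not good all go to [point]. *)
  pose S := [set w | exists q : nat * nat,
    W w q.1 q.2 /\ [set y | d (e q.2) y <= r q.1] `<=` U].
  have mS : measurable S.
    apply: measurable_exists => q.
    have [qU|qU] := pselect ([set y | d (e q.2) y <= r q.1] `<=` U).
      rewrite [X in measurable X](_ : _ = [set w | W w q.1 q.2]); first exact: measurable_bit.
      by apply/seteqP; split=> w //= [].
    by rewrite [X in measurable X](_ : _ = set0)//; apply/seteqP; split=> // w [].
  have -> : g @^-1` U = (good `&` S) `|` (~` good `&` (if pselect (U point) then setT else set0)).
    apply/seteqP; split=> w /=.
      have [gw Uw|ngw] := pselect (good w); last first.
        rewrite /g; case: pselect => //= ngw' Up; right; split=> //.
        by case: pselect.
      left; split=> //; have /nbhsd[a /rle[m ma] aU] : nbhs (g w : T) U by exact: open_nbhs_nbhs.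
      have [k wk] := gw.1 m; exists (m, k); split=> // y /= ky; apply: aU => /=.
      by have := gL w gw _ _ wk; have := dT (g w) (e k) y; rewrite (dC (g w) (e k)); lra.
    move=> [[gw [q [wq qU]]]|[ngw]].
      by apply: qU; exact: (gL w gw).
    by case: pselect => //= Up _; rewrite /g; case: pselect.
  apply: measurableU; first exact: measurableI.
  apply: measurableI; first exact: measurableC.
  by case: pselect => Up; [exact: measurableT|exact: measurable0].
- by move=> x; apply: (L_uniq _ _ _ (good_tau x)); [apply: gL; exact: good_tau|exact: L_tau].
Qed.

(** * Swapping along a measure on tuples *)

Section improvement.
Local Open Scope ereal_scope.
Context (R : realType) (X Y : ptopologicalType).
Context (mu : probability (borel X) R) (nu : probability (borel Y) R).
Context (c : X * Y -> \bar R) (pi : probability (borel X * borel Y)%type R).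
Local Notation Z := (borel X * borel Y)%type.
Hypothesis c_meas : measurable_fun [set: Z] c.
Hypothesis pi_optimal : optimal_plan c mu nu pi.
Hypothesis pi_cost : transport_cost c pi \is a fin_num.

Definition swap n (z : 'I_n -> X * Y) : 'I_n -> X * Y :=
  fun i => ((z i).1, (z (ordS i)).2).

Definition improving n (K eta : R) : set ('I_n -> X * Y) :=
  [set z | (forall i, `|c (z i)| <= K%:E /\ `|c (swap z i)| <= K%:E) /\
    \sum_(i < n) c (swap z i) + eta%:E <= \sum_(i < n) c (z i)].

Lemma cost_pos_neg_fin : \int[pi]_x c^\+ x \is a fin_num /\
  \int[pi]_x c^\- x \is a fin_num.
Proof.
have [_ hc _] := pi_optimal; move: pi_cost; rewrite /transport_cost integralE.
have : 0 <= \int[pi]_x c^\+ x by apply: integral_ge0.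
have : 0 <= \int[pi]_x c^\- x by apply: integral_ge0.
move: hc; rewrite /has_transport_cost.
by case: (\int[pi]_x c^\+ x) => [a| |]; case: (\int[pi]_x c^\- x) => [b| |] // [].
Qed.

Section decomposition.
Context d (Om : measurableType d) (n : nat) (sig lam : {measure set Om -> \bar R}).
Context (g : Om -> Z) (z : 'I_n -> Om -> Z).
Hypothesis mg : measurable_fun setT g.
Hypothesis mz : forall i, measurable_fun setT (z i).
Hypothesis piE : forall B, measurable B ->
  pi B = sig (g @^-1` B) + \sum_(i < n) lam (z i @^-1` B).

Let zs i w : Z := swap (z ^~ w) i.

Let mzs i : measurable_fun setT (zs i).
Proof.
apply: measurable_fun_pair; first exact: measurableT_comp measurable_fst (mz i).
exact: measurableT_comp measurable_snd (mz (ordS i)).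
Qed.

(** First coordinates are untouched and second ones are permuted by the bijection [ordS], so both
    marginals survive. *)
Lemma swapped_plan : exists pi' : probability Z R, transport_plan mu nu pi' /\
  forall f, measurable_fun setT f -> (forall x, 0 <= f x) ->
    \int[pi']_x f x =
    \int[sig]_w f (g w) + \sum_(i < n) \int[lam]_w f (zs i w).
Proof.
have [m [mE im]] := mixture_measure sig lam mg mzs.
have fstE (A : set (borel X)) : measurable A -> m (fst @^-1` A) = mu A.
  move=> mA; have [[pimu _] _ _] := pi_optimal; rewrite mE -(pimu A mA).
  rewrite /pushforward piE//; rewrite -[X in measurable X]setTI.
  exact: measurable_fst.
have sndE (B : set (borel Y)) : measurable B -> m (snd @^-1` B) = nu B.
  move=> mB; have [[_ pinu] _ _] := pi_optimal; rewrite mE -(pinu B mB).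
  rewrite /pushforward piE//; last first.
    by rewrite -[X in measurable X]setTI; exact: measurable_snd.
  by congr (_ + _); rewrite [RHS](reindex_inj (@ordS_inj n)).
have m1 : m setT = 1 by rewrite -(@probability_setT _ _ _ mu) -fstE// preimage_setT.
have [pi' pi'E] := probability_of_measure m1.
exists pi'; split; first by split=> [A mA|B mB]; rewrite /pushforward pi'E; [exact: fstE|exact: sndE].
move=> f mf f0; rewrite -im//; apply: eq_measure_integral => A _ _; exact: pi'E.
Qed.

Lemma integral_decomposition f : measurable_fun setT f -> (forall x, 0 <= f x) ->
  \int[pi]_x f x = \int[sig]_w f (g w) + \sum_(i < n) \int[lam]_w f (z i w).
Proof.
move=> mf f0; have [m [mE im]] := mixture_measure sig lam mg mz.
by rewrite -im//; apply: eq_measure_integral => A mA _; exact: etrans (piE mA) (esym (mE A)).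
Qed.

(** The gain with every term on the side where it is non-negative, ready for integration without
    subtracting infinities. *)
Lemma improving_pos_neg (K eta : R) (w : 'I_n -> X * Y) : improving K eta w ->
  \sum_(i < n) c^\+ (swap w i) + \sum_(i < n) c^\- (w i) + eta%:E <=
  \sum_(i < n) c^\+ (w i) + \sum_(i < n) c^\- (swap w i).
Proof.
move=> [cK].
have cE x : `|c x| <= K%:E -> c x = (fine (c x))%:E.
  by case: (c x) => //=; rewrite leye_eq.
have ca i := cE _ (cK i).1; have cb i := cE _ (cK i).2.
pose a i := fine (c (w i)); pose b i := fine (c (swap w i)).
rewrite (eq_bigr (fun i => (b i)%:E)) => [|i _]; last exact: cb.
rewrite [leRHS](eq_bigr (fun i => (a i)%:E)) => [|i _]; last exact: ca.
rewrite !sumEFin -EFinD lee_fin => ab.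
rewrite (eq_bigr (fun i => (Num.max (b i) 0)%:E)) => [|i _]; last first.
  by rewrite funeposE cb EFin_max.
rewrite [X in _ + X + _](eq_bigr (fun i => (Num.max (- a i) 0)%:E)) => [|i _]; last first.
  by rewrite funenegE ca -EFinN EFin_max.
rewrite [X in _ <= X + _](eq_bigr (fun i => (Num.max (a i) 0)%:E)) => [|i _]; last first.
  by rewrite funeposE ca EFin_max.
rewrite [X in _ <= _ + X](eq_bigr (fun i => (Num.max (- b i) 0)%:E)) => [|i _]; last first.
  by rewrite funenegE cb -EFinN EFin_max.
have posneg (f : 'I_n -> R) :
    (\sum_i Num.max (f i) 0 = \sum_i f i + \sum_i Num.max (- f i) 0)%R.
  rewrite -big_split/=; apply: eq_bigr => i _.
  by rewrite maxEle [in RHS]maxEle oppr_le0; case: leP => f0; case: leP => f0'; lra.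
rewrite !sumEFin -!EFinD lee_fin (posneg b) (posneg a); lra.
Qed.

(** Otherwise the swapped plan would be cheaper by at least [eta * lam setT]. Every integral in the
    comparison is finite: the old ones are summands of the finite cost parts of [pi], the swapped
    ones have integrands bounded by [K] almost everywhere for the finite measure [lam]. *)
Lemma improvement_null (K eta : R) : (0 < n)%N -> (0 < eta)%R ->
  {ae lam, forall w, improving K eta (z ^~ w)} -> lam setT = 0.
Proof.
move=> n0 eta0 imp.
have [fp fn] := cost_pos_neg_fin.
have mcp : measurable_fun [set: Z] c^\+ by exact: measurable_funepos.
have mcn : measurable_fun [set: Z] c^\- by exact: measurable_funeneg.
have c0p x : 0 <= c^\+ x by []. have c0n x : 0 <= c^\- x by [].
have [pi' [plan' i']] := swapped_plan.
have lamoo : lam setT \is a fin_num.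
  rewrite ge0_fin_numE//; apply: (@le_lt_trans _ _ (pi setT)); last first.
    by rewrite probability_setT ltry.
  rewrite piE// (bigD1 (Ordinal n0))//= preimage_setT addeCA leeDl//.
  by rewrite adde_ge0// sume_ge0.
have bfin (f : Z -> \bar R) : measurable_fun setT f -> (forall x, 0 <= f x) ->
    (forall x, f x <= `|c x|) -> \sum_(i < n) \int[lam]_w f (zs i w) \is a fin_num.
  move=> mf f0 fc; apply/sum_fin_numP => i _ _.
  rewrite ge0_fin_numE; last exact: integral_ge0.
  apply: (@le_lt_trans _ _ (\int[lam]_w `|K|%:E)); last first.
    by rewrite integral_cst// -(fineK lamoo) -EFinM ltry.
  apply: ae_ge0_le_integral => //.
  - exact: measurableT_comp mf (mzs i).
  - apply: filterS imp => w [cK _] _; apply: (le_trans (fc _)).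
    by apply: (le_trans (cK i).2); rewrite lee_fin ler_norm.
have /(bfin _ mcp c0p) bp x : c^\+ x <= `|c x|.
  by rewrite funeposE ge_max lee_abs abse_ge0.
have /(bfin _ mcn c0n) bn x : c^\- x <= `|c x|.
  by rewrite funenegE ge_max -abseN lee_abs abse_ge0.
have key : \sum_(i < n) \int[lam]_w c^\+ (zs i w) + \sum_(i < n) \int[lam]_w c^\- (z i w) +
      eta%:E * lam setT <=
    \sum_(i < n) \int[lam]_w c^\+ (z i w) + \sum_(i < n) \int[lam]_w c^\- (zs i w).
  have m1 f i : measurable_fun [set: Z] f -> measurable_fun setT (fun w => f (z i w) : \bar R).
    by move=> mf; exact: measurableT_comp mf (mz i).
  have m2 f i : measurable_fun [set: Z] f -> measurable_fun setT (fun w => f (zs i w) : \bar R).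
    by move=> mf; exact: measurableT_comp mf (mzs i).
  have msum (h : 'I_n -> Om -> \bar R) : (forall i, measurable_fun setT (h i)) ->
      measurable_fun setT (fun w => \sum_(i < n) h i w).
    exact: emeasurable_sum.
  have sum0 (h : 'I_n -> Om -> \bar R) w : (forall i, 0 <= h i w) -> 0 <= \sum_(i < n) h i w.
    by move=> h0; apply: sume_ge0.
  have intsum (h : 'I_n -> Om -> \bar R) : (forall i, measurable_fun setT (h i)) ->
      (forall i w, 0 <= h i w) ->
      \int[lam]_w (\sum_(i < n) h i w) = \sum_(i < n) \int[lam]_w h i w.
    by move=> mh h0; rewrite ge0_integral_sum.
  pose h1 i w := c^\+ (zs i w). pose h2 i w := c^\- (z i w).
  pose h3 i w := c^\+ (z i w). pose h4 i w := c^\- (zs i w).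
  have mh1 i : measurable_fun setT (h1 i) by exact: m2.
  have mh2 i : measurable_fun setT (h2 i) by exact: m1.
  have mh3 i : measurable_fun setT (h3 i) by exact: m1.
  have mh4 i : measurable_fun setT (h4 i) by exact: m2.
  have -> : eta%:E * lam setT = \int[lam]_w eta%:E by rewrite integral_cst.
  have eta0' : 0 <= eta%:E by rewrite lee_fin ltW.
  have e1 : \sum_(i < n) \int[lam]_w c^\+ (zs i w) = \int[lam]_w \sum_(i < n) h1 i w.
    by rewrite (intsum h1 mh1 (fun i w => c0p _)).
  have e2 : \sum_(i < n) \int[lam]_w c^\- (z i w) = \int[lam]_w \sum_(i < n) h2 i w.
    by rewrite (intsum h2 mh2 (fun i w => c0n _)).
  have e3 : \sum_(i < n) \int[lam]_w c^\+ (z i w) = \int[lam]_w \sum_(i < n) h3 i w.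
    by rewrite (intsum h3 mh3 (fun i w => c0p _)).
  have e4 : \sum_(i < n) \int[lam]_w c^\- (zs i w) = \int[lam]_w \sum_(i < n) h4 i w.
    by rewrite (intsum h4 mh4 (fun i w => c0n _)).
  rewrite e1 e2 e3 e4.
  have s1 w : 0 <= \sum_(i < n) h1 i w by apply: sum0 => i; exact: c0p.
  have s2 w : 0 <= \sum_(i < n) h2 i w by apply: sum0 => i; exact: c0n.
  have s3 w : 0 <= \sum_(i < n) h3 i w by apply: sum0 => i; exact: c0p.
  have s4 w : 0 <= \sum_(i < n) h4 i w by apply: sum0 => i; exact: c0n.
  have ms1 := msum _ mh1. have ms2 := msum _ mh2.
  have ms3 := msum _ mh3. have ms4 := msum _ mh4.
  rewrite -ge0_integralD// -ge0_integralD//; last 2 first.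
    by move=> w _; exact: adde_ge0.
    exact: emeasurable_funD.
  rewrite -ge0_integralD//; apply: ae_ge0_le_integral => //.
  - by move=> w _; rewrite !adde_ge0.
  - by apply: emeasurable_funD => //; exact: emeasurable_funD.
  - by move=> w _; rewrite adde_ge0.
  - exact: emeasurable_funD.
  - by apply: filterS imp => w /improving_pos_neg + _.
move: (fp) (fn); rewrite !integral_decomposition// => fpd fnd.
have := i' _ mcp c0p; have := i' _ mcn c0n => i'n i'p.
have cost' : has_transport_cost c pi'.
  left; rewrite i'p ltey_eq; apply/orP; left.
  rewrite fin_numD bp andbT; move: fpd; rewrite fin_numD; by case/andP.
have [_ _ /(_ _ plan' cost')] := pi_optimal.
have costE (P : probability Z R) :
    transport_cost c P = \int[P]_x c^\+ x - \int[P]_x c^\- x.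
  by rewrite /transport_cost integralE.
rewrite !costE [\int[pi]_x c^\+ x]integral_decomposition//
  [\int[pi]_x c^\- x]integral_decomposition// i'p i'n.
have L0 : 0 <= lam setT by exact: measure_ge0.
move: fpd; rewrite fin_numD => /andP[spf apf].
move: fnd; rewrite fin_numD => /andP[snf anf].
move: key L0; rewrite -(fineK spf) -(fineK apf) -(fineK snf) -(fineK anf).
rewrite -(fineK bp) -(fineK bn) -(fineK lamoo) -EFinM -!EFinD !lee_fin.
set sp := fine (\int[sig]_w _); set sn := fine (\int[sig]_w _).
set bp' := fine _; set an := fine _; set l := fine _; set ap := fine _; set bn' := fine _.
move: sp sn bp' an l ap bn' => sp sn bp' an l ap bn' key l0 opt.
have : (eta * l <= 0)%R by lra.
by rewrite pmulr_rle0// => l0'; congr EFin; apply/eqP; rewrite eq_le l0 l0'.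
Qed.

End decomposition.
End improvement.

(** * Cyclical monotonicity *)

Section deinterleave.
Context (n : nat) (i : 'I_n).

(** An [n]-tuple of bitstreams is coded as one bitstream, so that sets of tuples become subsets of
    the single Cantor space of [kellerer_null]. *)
Definition deinterleave (w : bitstream) : bitstream := fun k => w (k * n + i)%N.

Lemma clopens_deinterleave A : clopens A -> clopens (deinterleave @^-1` A).
Proof.
move=> [N dA]; exists (N * n)%N => w w' ww'; apply: dA => k kN; apply: ww'.
by rewrite (@leq_trans (k.+1 * n)%N)// ?leq_mul2r ?kN ?orbT// mulSn addnC ltn_add2r.
Qed.

Lemma measurable_deinterleave : measurable_fun setT deinterleave.
Proof. exact: measurable_reindex. Qed.

End deinterleave.

Lemma deinterleave_surj n (z : 'I_n -> bitstream) :
  exists w, forall i, deinterleave i w = z i.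
Proof.
case: n z => [|n] z; first by exists point => -[].
exists (fun q => z (inord (q %% n.+1)%N) (q %/ n.+1)%N) => i; apply/funext => k.
rewrite /deinterleave divnMDl// divn_small// addn0; congr (z _ _).
by rewrite modnMDl modn_small// inord_val.
Qed.

Section cyclical_monotonicity.
Local Open Scope ereal_scope.
Context (R : realType) (X Y : ptopologicalType).
Context (mu : probability (borel X) R) (nu : probability (borel Y) R).
Context (c : X * Y -> \bar R) (pi : probability (borel X * borel Y)%type R).
Local Notation Z := (borel X * borel Y)%type.
Hypothesis c_ninfty : forall z, c z != -oo.
Hypothesis c_meas : measurable_fun [set: Z] c.
Hypothesis pi_optimal : optimal_plan c mu nu pi.
Hypothesis pi_cost : transport_cost c pi \is a fin_num.

Lemma measurable_improving d (Om : measurableType d) n (z : 'I_n -> Om -> Z) (K eta : R) :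
  (forall i, measurable_fun setT (z i)) ->
  measurable [set w | improving c K eta (z ^~ w)].
Proof.
move=> mz.
have mcz i : measurable_fun setT (fun w => c (z i w)) by exact: measurableT_comp c_meas (mz i).
have mcs i : measurable_fun setT (fun w => c (swap (z ^~ w) i)).
  have : measurable_fun setT (fun w => swap (z ^~ w) i : Z).
    apply: measurable_fun_pair; first exact: measurableT_comp measurable_fst (mz i).
    exact: measurableT_comp measurable_snd (mz (ordS i)).
  exact: measurableT_comp.
have mle (f h : Om -> \bar R) : measurable_fun setT f -> measurable_fun setT h ->
    measurable [set w | f w <= h w].
  by move=> mf mh; rewrite -[X in measurable X]setTI; exact: measurable_lee.
apply: measurableI.
  apply: measurable_forall => i; apply: measurableI; apply: mle;
    do ?exact: measurable_cst; exact: measurableT_comp.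
apply: mle; last exact: emeasurable_sum.
by apply: emeasurable_funD; [exact: emeasurable_sum|exact: measurable_cst].
Qed.

(** Kellerer's alternative for the image of [pi] under [tau]: its second case, read through [g],
    decomposes [pi] in a way that [improvement_null] excludes. The condition [0 < n] sits in the
    conclusion so that [A] can be chosen for all pairs of integers at once. *)
Lemma improving_null_cover (tau : Z -> bitstream) (g : bitstream -> Z) n (K eta : R) :
  measurable_fun setT tau -> measurable_fun setT g -> cancel tau g -> (0 < eta)%R ->
  exists A : set bitstream, [/\ measurable A, pi (tau @^-1` A) = 0 &
    (0 < n)%N -> forall w, improving c K eta (fun i : 'I_n => g (deinterleave i w)) ->
      exists i : 'I_n, A (deinterleave i w)].
Proof.
move=> mtau mg tauK eta0; have [n0|n0] := ltnP 0 n; last first.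
  by exists set0; split; rewrite ?preimage_set0 ?measure0// ltnNge n0.
have [m [mE _]] := pushforward_measure pi mtau.
have [|rho rhoE] := @probability_of_measure R _ bitstream m.
  by rewrite mE preimage_setT; exact: probability_setT.
have mz (i : 'I_n) : measurable_fun setT (fun w => g (deinterleave i w)).
  exact: measurableT_comp mg (measurable_deinterleave i).
have [[A [mA A0 Acov]]|[lam [sig [lam0 lamT rhoD]]]] :=
    kellerer_null rho n0 (@clopens_deinterleave n) (measurable_improving K eta mz).
  by exists A; split=> //; rewrite -mE -rhoE.
have imp : {ae lam, forall w, improving c K eta (fun i : 'I_n => g (deinterleave i w))}.
  apply/negligibleP; first exact/measurableC/measurable_improving.
  exact: lam0.
suff L0 : lam setT = 0 by rewrite L0 ltxx in lamT.
apply: (improvement_null c_meas pi_optimal pi_cost mg mz _ n0 eta0 imp) => B mB.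
have mgB : measurable (g @^-1` B) by rewrite -[X in measurable X]setTI; exact: mg.
apply: etrans (rhoD _ mgB); rewrite rhoE mE; congr (pi _).
by apply/seteqP; split=> x /=; rewrite tauK.
Qed.

(** One integer bounds the costs and the inverse of the gain, so countably many pairs [(n, M)]
    capture every violation. *)
Lemma not_monotone_improving n (z : 'I_n -> X * Y) :
  (forall i, c (z i) < +oo) -> \sum_(i < n) c (swap z i) < \sum_(i < n) c (z i) ->
  exists M : nat, improving c M%:R M.+1%:R^-1 z.
Proof.
move=> czoo lt.
have cfin x : c x < +oo -> c x = (fine (c x))%:E.
  by move=> cx; rewrite fineK// fin_numE c_ninfty/= lt_eqF.
have ca i := cfin _ (czoo i).
have csoo i : c (swap z i) < +oo.
  (* No term is [-oo], so one infinite swapped cost would make the whole sum [+oo], contradicting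
     the strict inequality. *)
  rewrite ltey; apply/eqP => ci.
  suff : \sum_(i < n) c (swap z i) = +oo.
    by move=> sE; move: lt; rewrite sE ltNge leey.
  by apply/esum_eqyP => //; exists i.
have cb i := cfin _ (csoo i).
pose a i := fine (c (z i)); pose b i := fine (c (swap z i)).
have aE : \sum_(i < n) c (z i) = (\sum_i a i)%:E.
  by rewrite -sumEFin; apply: eq_bigr => i _; exact: ca.
have bE : \sum_(i < n) c (swap z i) = (\sum_i b i)%:E.
  by rewrite -sumEFin; apply: eq_bigr => i _; exact: cb.
rewrite aE bE lte_fin -subr_gt0 in lt.
have [M0 M0P] := ltr_add_invr lt; rewrite add0r in M0P.
pose B := (\sum_i `|a i| + \sum_i `|b i|)%R.
pose M := maxn M0 (Num.truncn B).+1.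
have BM : (B <= M%:R)%R.
  by apply: (le_trans (ltW (truncnS_gt B))); rewrite ler_nat leq_maxr.
have le_sum_norm (f : 'I_n -> R) i : (`|f i| <= \sum_i `|f i|)%R.
  by rewrite (bigD1 i)//= lerDl sumr_ge0.
have sum_norm_ge0 (f : 'I_n -> R) : (0 <= \sum_i `|f i|)%R by exact: sumr_ge0.
exists M; split=> [i|].
  have := le_sum_norm a i; have := le_sum_norm b i.
  have := sum_norm_ge0 a; have := sum_norm_ge0 b.
  by rewrite ca cb /= !lee_fin -/(a i) -/(b i) /B in BM *; split; lra.
rewrite aE bE -EFinD lee_fin.
rewrite -lerBrDl; apply: le_trans (ltW M0P).
by rewrite lef_pV2 ?posrE ?ltr0n// ler_nat ltnS leq_maxl.
Qed.

Lemma optimal_plan_cyclically_monotone : borel_retract (borel X) ->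
  borel_retract (borel Y) -> c_cyclically_monotone_plan c pi.
Proof.
move=> rX rY; have [tau [g [mtau mg tauK]]] := borel_retract_prod rX rY.
have /choice[A AP] (p : nat * nat) := @improving_null_cover tau g p.1 p.2%:R p.2.+1%:R^-1
  mtau mg tauK ltac:(by rewrite invr_gt0).
pose Gamma := [set z : Z | c z < +oo] `&` [set z | forall p, ~ A p (tau z)].
have mtauA p : measurable (tau @^-1` A p).
  by have [mA _ _] := AP p; rewrite -[X in measurable X]setTI; exact: mtau.
have mG : measurable Gamma.
  apply: measurableI; last by apply: measurable_forall => p; exact: measurableC (mtauA p).
  rewrite -[X in measurable X]setTI; apply: measurable_lte => //; exact: measurable_cst.
exists Gamma; split=> //.
- suff G0 : pi (~` Gamma) = 0.
    by rewrite -[Gamma]setCK probability_setC ?G0 ?sube0//; exact: measurableC.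
  apply: measure_negligible; first exact: measurableC.
  rewrite setCI; apply: negligibleU.
    have [fp _] := cost_pos_neg_fin pi_optimal pi_cost.
    have ip : pi.-integrable setT c^\+.
      apply/integrableP; split; first exact: measurable_funepos.
      by under eq_integral do rewrite gee0_abs//; rewrite ltey_eq fp.
    have := integrable_ae measurableT ip; apply: negligibleS => z /= cz H.
    apply: cz; have := H I; rewrite funeposE.
    by case: (c z) => [r _| |_]; rewrite ?ltry ?maxye ?ltNyr.
  (* Numbers that code no pair contribute [A (0, 0)], whose preimage is null as well. *)
  have -> : ~` [set z | forall p, ~ A p (tau z)] = \bigcup_k
      (tau @^-1` (A (odflt (0, 0)%N (unpickle k)))).
    apply/seteqP; split=> z /=.
      by move=> /existsNP[p /contrapT Ap]; exists (pickle p) => //; rewrite /= pickleK.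
    by move=> [k _ Ak] /(_ _ Ak).
  apply: negligible_bigcup => k; apply/negligibleP; first exact: mtauA.
  by have [_ + _] := AP (odflt (0, 0)%N (unpickle k)).
- move=> n z zG; rewrite leNgt; apply/negP => lt.
  have [M imp] := not_monotone_improving (fun i => (zG i).1) lt.
  have n0 : (0 < n)%N by case: (n) z zG lt imp => // z _; rewrite !big_ord0 ltxx.
  (* A single bitstream codes the offending tuple; [tauK] decodes it back to [z], so the cover
     [A (n, M)] must contain some [tau (z i)], which [Gamma] forbids. *)
  have [w wz] := deinterleave_surj (fun i => tau (z i)).
  have [_ _ /(_ n0 w)] := AP (n, M).
  have -> : (fun i : 'I_n => g (deinterleave i w)) = z.
    by apply/funext => i; rewrite wz tauK.
  by move=> /(_ imp)[i]; rewrite wz; exact: (zG i).2.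
Qed.

End cyclical_monotonicity.

Local Open Scope ereal_scope.

Theorem theorem1 (R : realType) (X Y : ptopologicalType)
  (hX : polish_space R X) (hXc : locally_compact [set: X])
  (hY : polish_space R Y) (hYc : locally_compact [set: Y])
  (mu : probability (borel X) R) (nu : probability (borel Y) R)
  (c : X * Y -> \bar R)
  (c_ninfty : forall z, c z != -oo)
  (c_meas : measurable_fun [set: (borel X * borel Y)%type] c)
  (c_locint : forall K : set (X * Y), compact K -> (mu \x nu).-integrable K c)
  (pi : probability (borel X * borel Y)%type R)
  (hopt : optimal_plan c mu nu pi)
  (hfin : transport_cost c pi \is a fin_num) :
  c_cyclically_monotone_plan c pi.
Proof.
apply: (optimal_plan_cyclically_monotone c_ninfty c_meas hopt hfin).
  exact: polish_borel_retract hX.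
exact: polish_borel_retract hY.
Qed.
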